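(* Let $c$ be a complex number with $\Re c>0$, let $\alpha$ be a real number with $0<\alpha\le 1$, and let $n$ be a positive integer. Then the function $$R_{\alpha,c,n}(z)=g_c(z)^\alpha+\frac{n\alpha z g_c'(z)}{g_c(z)}=\left(\frac{c+\bar c z}{1-z}\right)^{\alpha}+\frac{2n\alpha(\Re c)z}{(1-z)(c+\bar c z)}$$ is univalent on $|z|<1$. Moreover, if a function $q\in\mathcal{H}[c^\alpha,n]$ satisfies the condition $$q(z)+\frac{zq'(z)}{q(z)}\in R_{\alpha,c,n}(\mathbb{D})\quad\text{for all } z\in\mathbb{D},$$ then $|\arg q(z)|<\pi\alpha/2$ for all $z\in\mathbb{D}$.
   Context: $\mathbb{D}=\{z\in\mathbb{C}:|z|<1\}$. For $a\in\mathbb{C}$ and a positive integer $n$, $\mathcal{H}[a,n]$ is the set of holomorphic functions $h$ on $\mathbb{D}$ of the form $h(z)=a+c_nz^n+c_{n+1}z^{n+1}+\cdots$. For $\Re c>0$, $g_c(z)=\dfrac{c+\bar c z}{1-z}$ is the M\''obius transformation mapping $\mathbb{D}$ onto the right half-plane with $g_c(0)=c$; the power is $g_c^\alpha=\exp(\alpha\log g_c)$ with the branch of the logarithm satisfying $|\Im\log g_c|<\pi/2$, and $c^\alpha=g_c(0)^\alpha$ is the principal power. ''Univalent'' means holomorphic and injective. The condition on $q(z)+zq'(z)/q(z)$ is understood to include that $q(z)\ne0$ on $\mathbb{D}$. The conclusion $|\arg q(z)|<\pi\alpha/2$ means that $q(z)\neq 0$ and its principal argument has absolute value less than $\pi\alpha/2$.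 *)

(* Defs.v *)
From Stdlib Require Import Reals Lra.
From Coquelicot Require Import Coquelicot.
Open Scope R_scope.

Definition disk (z : C) : Prop := Cmod z < 1.

Definition Cexp (z : C) : C := (exp (Re z) * cos (Im z), exp (Re z) * sin (Im z)).

(* Principal argument, with values in (-PI, PI] for z <> 0; its value at 0 is
   meaningless. *)
Definition Carg (z : C) : R :=
  if Rle_dec 0 (Im z) then acos (Re z / Cmod z) else - acos (Re z / Cmod z).

Definition Clog (z : C) : C := (ln (Cmod z), Carg z).

(* Principal power, meant for z <> 0. By [Clog_Im_right] below, on the right
   half-plane this is the branch with |Im log| < PI/2. *)
Definition Cpower (z : C) (alpha : R) : C := Cexp (RtoC alpha * Clog z)%C.

Definition holomorphic_on_disk (f : C -> C) : Prop :=
  forall z : C, disk z -> ex_derive (K := C_AbsRing) (V := C_NormedModule) f z.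

Definition univalent_on_disk (f : C -> C) : Prop :=
  holomorphic_on_disk f /\
  forall z w : C, disk z -> disk w -> f z = f w -> z = w.

Definition classH (a : C) (n : nat) (h : C -> C) : Prop :=
  holomorphic_on_disk h /\
  exists b : nat -> C,
    b 0%nat = a /\
    (forall k : nat, (0 < k < n)%nat -> b k = RtoC 0) /\
    forall z : C, disk z ->
      is_pseries (K := C_AbsRing) (V := C_NormedModule) b z (h z).

Definition g (c z : C) : C := ((c + Cconj c * z) / (1 - z))%C.

(* Coquelicot's [C_derive f z] is defined by a limit along the real direction;
   it is the complex derivative wherever the latter exists
   ([is_C_derive_unique]). *)
Definition Rfun (alpha : R) (c : C) (n : nat) (z : C) : C :=
  (Cpower (g c z) alpha
   + RtoC (INR n) * RtoC alpha * z * C_derive (g c) z / g c z)%C.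

Lemma Cmod_sq (z : C) : Cmod z * Cmod z = Re z * Re z + Im z * Im z.
Proof.
  unfold Cmod. rewrite sqrt_sqrt; unfold Re, Im; nra.
Qed.

Lemma Re_div_Cmod (z : C) : z <> RtoC 0 -> -1 <= Re z / Cmod z <= 1.
Proof.
  intros Hz. pose proof (proj1 (Cmod_gt_0 z) Hz) as Hp.
  pose proof (Cmod_sq z) as Hs.
  assert (E : Re z = Re z / Cmod z * Cmod z) by (field; lra).
  set (t := Re z / Cmod z) in *. clearbody t. rewrite E in Hs.
  assert (Ht : t * t <= 1).
  { destruct (Rle_lt_dec (t * t) 1) as [|H]; [assumption|].
    pose proof (Rmult_lt_0_compat _ _ Hp Hp). nra. }
  split; nra.
Qed.

Lemma Cexp_Clog (z : C) : z <> RtoC 0 -> Cexp (Clog z) = z.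
Proof.
  intros Hz. pose proof (proj1 (Cmod_gt_0 z) Hz) as Hp.
  pose proof (Re_div_Cmod z Hz) as Hb. pose proof (Cmod_sq z) as Hs.
  assert (Hsin : Cmod z * sin (acos (Re z / Cmod z)) = Rabs (Im z)).
  { rewrite sin_acos by exact Hb.
    rewrite <- (sqrt_Rsqr (Cmod z)) at 1 by lra.
    rewrite <- sqrt_mult_alt by apply Rle_0_sqr.
    rewrite <- sqrt_Rsqr_abs. f_equal. unfold Rsqr.
    replace (Im z * Im z) with (Cmod z * Cmod z - Re z * Re z) by lra.
    field. lra. }
  assert (Hcos : Cmod z * cos (acos (Re z / Cmod z)) = Re z).
  { rewrite cos_acos by exact Hb. field. lra. }
  unfold Cexp, Clog, Carg. cbn [Re Im fst snd]. rewrite exp_ln by exact Hp.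
  destruct (Rle_dec 0 (Im z)) as [H|H].
  - rewrite Hcos, Hsin, Rabs_pos_eq by exact H. destruct z; reflexivity.
  - rewrite cos_neg, sin_neg, Hcos.
    replace (Cmod z * - sin (acos (Re z / Cmod z))) with (Im z).
    + destruct z; reflexivity.
    + rewrite Rabs_left in Hsin by lra. lra.
Qed.

Lemma Carg_bound (z : C) : z <> RtoC 0 -> - PI < Carg z <= PI.
Proof.
  intros Hz. pose proof PI_RGT_0. pose proof (acos_bound (Re z / Cmod z)) as Ha.
  unfold Carg. destruct (Rle_dec 0 (Im z)) as [H0|H0]; [lra|].
  split; [|lra].
  destruct (Req_dec (acos (Re z / Cmod z)) PI) as [E|E]; [|lra].
  exfalso. pose proof (proj1 (Cmod_gt_0 z) Hz) as Hp.
  pose proof (Re_div_Cmod z Hz) as Hb. pose proof (Cmod_sq z) as Hs.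
  apply (f_equal cos) in E. rewrite cos_acos, cos_PI in E by exact Hb.
  assert (Re z = - Cmod z).
  { replace (Re z) with (Re z / Cmod z * Cmod z) by (field; lra).
    rewrite E. ring. }
  nra.
Qed.

Lemma Clog_Im_right (z : C) : 0 < Re z -> Rabs (Im (Clog z)) < PI / 2.
Proof.
  intros Hr.
  assert (Hz : z <> RtoC 0) by (intros ->; cbn in Hr; lra).
  pose proof (proj1 (Cmod_gt_0 z) Hz) as Hp.
  pose proof (Re_div_Cmod z Hz) as Hb.
  pose proof (Rdiv_lt_0_compat _ _ Hr Hp) as Hq.
  pose proof (acos_bound (Re z / Cmod z)) as Ha.
  assert (acos (Re z / Cmod z) < PI / 2).
  { apply Rnot_le_lt. intros H.
    pose proof (cos_le_0 (acos (Re z / Cmod z)) H) as Hc.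
    rewrite cos_acos in Hc by exact Hb. lra. }
  unfold Clog, Carg. cbn [Im snd].
  destruct (Rle_dec 0 (Im z)); apply Rabs_def1; lra.
Qed.

Lemma g_right (c z : C) : 0 < Re c -> disk z -> 0 < Re (g c z).
Proof.
  intros Hc Hz. unfold disk in Hz. pose proof (Cmod_ge_0 z).
  pose proof (Cmod_sq z) as Hs.
  destruct c as [a b], z as [x y]. unfold Re, Im in *. cbn [fst snd] in *.
  assert (Hxy : x * x + y * y < 1) by nra.
  assert (Hd : 0 < (1 - x) * (1 - x) + y * y) by nra.
  replace (fst (g (a, b) (x, y)))
    with (a * (1 - (x * x + y * y)) / ((1 - x) * (1 - x) + y * y)).
  - apply Rdiv_lt_0_compat; [apply Rmult_lt_0_compat; lra | exact Hd].
  - unfold g, Cdiv, Cminus, Cinv, Cmult, Cplus, Copp, Cconj, RtoC.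
    cbn [fst snd]. field.
    intros E; nra.
Qed.

(* Main.v *)
(* In the coordinate [zeta = log g_c(z)], which ranges over the strip [|Im zeta| < PI/2], the
   function [R_{alpha,c,n}] becomes
     [F(zeta) = exp(alpha zeta) + K (exp zeta - |c|^2 exp(- zeta)) + const],  [K > 0],
   and [Re F' > 0], so that [Re (conj d (F(zeta + d) - F(zeta))) > 0] when [zeta] is in the strip
   and [zeta + d <> zeta] in its closure.  This gives univalence; it also shows that
   [F(zeta0) + i tau] is not a value of [F] on the open strip when [zeta0] lies on the upper
   (lower) edge and [tau >= 0] ([tau <= 0]).

   If [q] leaves the sector [|arg| < PI alpha / 2], let [z1] be a first exit point.  Then
   [p = q^(1/alpha)] maps [|z| < |z1|] into the right half-plane and [p(z1) = i y], so Jack's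
   lemma applies to [h = (p - c)/(p + conj c)] and yields [z1 h'(z1) = m h(z1)] with [m >= n].
   Rewritten in terms of [q], this makes [q + z q'/q] at [z1] one of the excluded values.

   Jack's lemma rests on the maximum principle for [|h|^2 |z|^(-2s) + delta |z|^2], [s < n]: in
   the coordinate [log z] it is a sum of squared moduli of holomorphic functions, whose
   Laplacian is positive.  Only twice complex differentiability of [h] is needed, and for [q] it
   comes from its power series. *)

Require Import Defs.
From Stdlib Require Import Reals Lra Lia ClassicalEpsilon.
From Coquelicot Require Import Coquelicot.
Open Scope R_scope.

(** * Complex derivatives *)

(** Univalence and subordination share one identity. With [p = g c z] one has
    [z = (p - c)/(p + Cconj c)] and [z g'/g = (p - c)(p + Cconj c)/(2 (Re c) p) = (p - |c|^2/p - 2 i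
    Im c)/(2 Re c)], whence [K], [|c|^2] and the additive constant in [F]. Jack's lemma gives
    [alpha m] times the same expression for [z q'/q] at [z1], where [R] has [n alpha]. At [p = i y]
    the expression is [i |p - c|^2/(2 y Re c)], so replacing [n] by [m] moves a boundary value of
    [F] vertically, in the direction of the sign of [y].

    The obstacle in Jack's lemma is the origin: [|h|^2 |z|^(-2n)] is bounded there but need not tend
    to 0, so a maximum could hide at 0. For [s < n] the weighted function does tend to 0, and [s]
    goes to [n] only at the end, in an inequality between derivatives. The term with [delta] makes
    the Laplacian strictly positive, so the second-derivative test alone excludes an interior
    maximum. *)

Notation Cder f z d := (is_derive (K := C_AbsRing) (V := C_NormedModule) f z d).

(** All hand-made estimates use this division-free form, in which [w = z] is allowed and no
    punctured neighbourhood has to be handled. *)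
Lemma Cder_eps (f : C -> C) (z d : C) :
  Cder f z d <->
  forall eps, 0 < eps -> exists delta, 0 < delta /\
    forall w, Cmod (w - z) < delta ->
      Cmod (f w - f z - d * (w - z)) <= eps * Cmod (w - z).
Proof.
  split.
  - intros [_ H] eps He.
    destruct (H z (fun P HP => HP) (mkposreal eps He)) as [delta Hd].
    exists delta. split; [apply cond_pos|]. intros w Hw.
    specialize (Hd w Hw). cbn in Hd.
    unfold norm, minus, plus, opp, scal, mult in Hd; cbn in Hd.
    unfold mult in Hd; cbn in Hd.
    replace (f w - f z - d * (w - z))%C
      with (f w + - f z + - ((w + - z) * d))%C by ring.
    exact Hd.
  - intros H. split; [apply is_linear_scal_l|].
    intros x Hx eps.
    rewrite <- (is_filter_lim_locally_unique (V := AbsRing_NormedModule C_AbsRing) z x Hx).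
    clear x Hx.
    destruct (H eps (cond_pos eps)) as [delta [Hd0 Hd]].
    exists (mkposreal delta Hd0). intros w Hw. specialize (Hd w Hw).
    unfold norm, minus, plus, opp, scal, mult; cbn.
    unfold mult; cbn.
    replace (f w + - f z + - ((w + - z) * d))%C
      with (f w - f z - d * (w - z))%C by ring.
    exact Hd.
Qed.

(* [C_NormedModule] and the ring [C_AbsRing] seen as a module over itself carry
   different, though equivalent, uniform structures. *)
Lemma Cder_absring (f : C -> C) (z d : C) :
  is_derive (K := C_AbsRing) (V := AbsRing_NormedModule C_AbsRing) f z d <-> Cder f z d.
Proof.
  split; intros [_ H]; (split; [apply is_linear_scal_l|]);
    intros x Hx eps; exact (H x Hx eps).
Qed.

Lemma Cder_ext_loc (f g : C -> C) (z d : C) (delta : R) :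
  0 < delta -> (forall w, Cmod (w - z) < delta -> f w = g w) ->
  Cder f z d -> Cder g z d.
Proof.
  intros Hd H. apply (is_derive_ext_loc (K := C_AbsRing) (V := C_NormedModule)).
  exists (mkposreal delta Hd). intros w Hw. apply H. exact Hw.
Qed.

Lemma Cder_const (a z : C) : Cder (fun _ => a) z (RtoC 0).
Proof. apply (is_derive_const (K := C_AbsRing) (V := C_NormedModule)). Qed.

Lemma Cder_id (z : C) : Cder (fun w => w) z (RtoC 1).
Proof. apply Cder_absring, (is_derive_id (K := C_AbsRing)). Qed.

Lemma Cder_plus (f g : C -> C) (z a b : C) :
  Cder f z a -> Cder g z b -> Cder (fun w => f w + g w)%C z (a + b)%C.
Proof. apply (is_derive_plus (K := C_AbsRing) (V := C_NormedModule)). Qed.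

Lemma Cder_mult (f g : C -> C) (z a b : C) :
  Cder f z a -> Cder g z b ->
  Cder (fun w => f w * g w)%C z (a * g z + f z * b)%C.
Proof.
  rewrite <- !Cder_absring. intros Hf Hg.
  apply (is_derive_mult (K := C_AbsRing) f g z a b Hf Hg).
  intros; apply Cmult_comm.
Qed.

Lemma Cder_comp (f g : C -> C) (z a b : C) :
  Cder f (g z) a -> Cder g z b -> Cder (fun w => f (g w)) z (b * a)%C.
Proof.
  intros Hf Hg. apply Cder_absring in Hg.
  exact (is_derive_comp (K := C_AbsRing) (V := C_NormedModule) f g z a b Hf Hg).
Qed.

Lemma Cder_cont (f : C -> C) (z d : C) :
  Cder f z d ->
  forall eps, 0 < eps -> exists delta, 0 < delta /\
    forall w, Cmod (w - z) < delta -> Cmod (f w - f z) < eps.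
Proof.
  intros H eps He. rewrite Cder_eps in H.
  destruct (H 1 Rlt_0_1) as [delta [Hd0 Hd]].
  pose proof (Cmod_ge_0 d) as Hp.
  exists (Rmin delta (eps / (2 + Cmod d))). split.
  - apply Rmin_pos; [exact Hd0|]. apply Rdiv_lt_0_compat; lra.
  - intros w Hw.
    pose proof (Rmin_l delta (eps / (2 + Cmod d))).
    pose proof (Rmin_r delta (eps / (2 + Cmod d))).
    specialize (Hd w ltac:(lra)).
    replace (f w - f z)%C with ((f w - f z - d * (w - z)) + d * (w - z))%C by ring.
    eapply Rle_lt_trans; [apply Cmod_triangle|].
    rewrite Cmod_mult. pose proof (Cmod_ge_0 (w - z)%C).
    assert (Cmod (w - z) * (2 + Cmod d) < eps).
    { apply Rmult_lt_reg_r with (/ (2 + Cmod d)); [apply Rinv_0_lt_compat; lra|].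
      rewrite Rmult_assoc, Rinv_r, Rmult_1_r by lra.
      change (eps * / (2 + Cmod d)) with (eps / (2 + Cmod d)). lra. }
    assert (0 <= Cmod (w - z) * Cmod d) by nra.
    destruct (Req_dec (Cmod (w - z)) 0) as [E|E].
    + rewrite E in *. lra.
    + nra.
Qed.

Lemma Cder_inv (z : C) : z <> RtoC 0 -> Cder (fun w => / w)%C z (- / (z * z))%C.
Proof.
  intros Hz. pose proof (proj1 (Cmod_gt_0 z) Hz) as Hp.
  rewrite Cder_eps. intros eps He.
  set (m := Cmod z) in *.
  (* The first bound keeps [|w| > m/2]; the remainder [(w - z)^2/(z^2 w)] is then at most
     [2 h^2/m^3] with [h = |w - z|], and the second bound turns this into [eps h]. *)
  exists (Rmin (m / 2) (eps * (m * m * m) / 2)). split.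
  - apply Rmin_pos; [lra|]. apply Rdiv_lt_0_compat; [|lra].
    repeat apply Rmult_lt_0_compat; assumption.
  - intros w Hw.
    pose proof (Rmin_l (m / 2) (eps * (m * m * m) / 2)).
    pose proof (Rmin_r (m / 2) (eps * (m * m * m) / 2)).
    assert (Hwm : m / 2 < Cmod w).
    { pose proof (Cmod_triangle (z - w) w) as T.
      replace (z - w + w)%C with z in T by ring.
      replace (z - w)%C with (- (w - z))%C in T by ring. rewrite Cmod_opp in T.
      fold m in T. lra. }
    assert (Hw0 : w <> RtoC 0) by (apply Cmod_gt_0; lra).
    replace (/ w - / z - - / (z * z) * (w - z))%C
      with ((w - z) * (w - z) / (z * z * w))%C by (field; split; assumption).
    rewrite Cmod_div by (repeat apply Cmult_neq_0; assumption).
    rewrite !Cmod_mult. fold m.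
    set (h := Cmod (w - z)) in *. assert (0 <= h) by apply Cmod_ge_0.
    assert (0 < m * m) by nra.
    apply Rmult_le_reg_r with (m * m * Cmod w); [nra|].
    unfold Rdiv. rewrite (Rmult_assoc (h * h)), Rinv_l by nra.
    assert (h * 2 <= eps * (m * m * m)) by lra.
    assert (m * m * m <= m * m * Cmod w * 2) by nra.
    assert (eps * (m * m * m) <= eps * (m * m * Cmod w * 2)) by (apply Rmult_le_compat_l; lra).
    nra.
Qed.

(** * The complex exponential *)

Lemma Cexp_plus (z w : C) : Cexp (z + w)%C = (Cexp z * Cexp w)%C.
Proof.
  destruct z as [a b], w as [x y]. unfold Cexp, Cplus, Cmult, Re, Im; cbn [fst snd].
  rewrite exp_plus, cos_plus, sin_plus. f_equal; ring.
Qed.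

Lemma Cexp_0 : Cexp (RtoC 0) = RtoC 1.
Proof.
  unfold Cexp, RtoC, Re, Im; cbn [fst snd]. rewrite exp_0, cos_0, sin_0.
  f_equal; ring.
Qed.

Lemma Cmod_Cexp (z : C) : Cmod (Cexp z) = exp (Re z).
Proof.
  unfold Cexp, Cmod; cbn [fst snd].
  replace ((exp (Re z) * cos (Im z)) ^ 2 + (exp (Re z) * sin (Im z)) ^ 2)
    with (Rsqr (exp (Re z))).
  - apply sqrt_Rsqr. left; apply exp_pos.
  - pose proof (sin2_cos2 (Im z)) as H. unfold Rsqr in *.
    replace (exp (Re z) * exp (Re z)) with
      (exp (Re z) * exp (Re z) * (sin (Im z) * sin (Im z) + cos (Im z) * cos (Im z)))
      by (rewrite H; ring). ring.
Qed.

Lemma Cexp_neq_0 (z : C) : Cexp z <> RtoC 0.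
Proof. apply Cmod_gt_0. rewrite Cmod_Cexp. apply exp_pos. Qed.

Lemma Cexp_opp (z : C) : Cexp (- z)%C = (/ Cexp z)%C.
Proof.
  assert (E : (Cexp (- z) * Cexp z)%C = RtoC 1).
  { rewrite <- Cexp_plus. replace (- z + z)%C with (RtoC 0) by ring. apply Cexp_0. }
  pose proof (Cexp_neq_0 z).
  replace (Cexp (- z)) with (Cexp (- z) * Cexp z * / Cexp z)%C by (field; assumption).
  rewrite E. ring.
Qed.

Lemma im_le_Cmod (z : C) : Rabs (Im z) <= Cmod z.
Proof.
  eapply Rle_trans; [|apply Rmax_Cmod]. apply Rmax_r.
Qed.

Lemma Cmod_le_Re_Im (z : C) : Cmod z <= Rabs (Re z) + Rabs (Im z).
Proof.
  pose proof (Cmod_sq z). pose proof (Cmod_ge_0 z).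
  pose proof (Rabs_pos (Re z)). pose proof (Rabs_pos (Im z)).
  pose proof (Rsqr_abs (Re z)). pose proof (Rsqr_abs (Im z)). unfold Rsqr in *.
  nra.
Qed.

Lemma derivable_pt_lim_at_0 (f : R -> R) (l : R) :
  derivable_pt_lim f 0 l ->
  forall eps, 0 < eps -> exists delta, 0 < delta /\
    forall x, Rabs x < delta -> Rabs (f x - f 0 - l * x) <= eps * Rabs x.
Proof.
  intros H eps He. destruct (H eps He) as [delta Hd].
  exists delta. split; [apply cond_pos|]. intros x Hx.
  destruct (Req_dec x 0) as [->|Hx0].
  - replace (f 0 - f 0 - l * 0) with 0 by ring. rewrite Rabs_R0. lra.
  - specialize (Hd x Hx0 Hx). rewrite Rplus_0_l in Hd.
    replace (f x - f 0 - l * x) with (((f x - f 0) / x - l) * x) by (field; assumption).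
    rewrite Rabs_mult. apply Rmult_le_compat_r; [apply Rabs_pos|lra].
Qed.

Lemma Cder_Cexp_0 : Cder Cexp (RtoC 0) (RtoC 1).
Proof.
  rewrite Cder_eps. intros eps He0.
  (* The four error terms below are at most [e m], [2 e m], [4 e m] and [e m] with [m = |w|], hence
     the 8. The bound [e <= 1] gives [|1 + x| <= 2]. *)
  set (e := Rmin (eps / 8) 1).
  assert (He : 0 < e) by (apply Rmin_pos; lra).
  assert (He1 : e <= 1) by apply Rmin_r.
  assert (He8 : 8 * e <= eps) by (pose proof (Rmin_l (eps / 8) 1); fold e in H; lra).
  clearbody e.
  destruct (derivable_pt_lim_at_0 exp 1) with (eps := e) as [d1 [Hd1 H1]]; auto.
  { rewrite <- exp_0. apply derivable_pt_lim_exp. }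
  destruct (derivable_pt_lim_at_0 sin 1) with (eps := e) as [d2 [Hd2 H2]]; auto.
  { rewrite <- cos_0. apply derivable_pt_lim_sin. }
  destruct (derivable_pt_lim_at_0 cos 0) with (eps := e) as [d3 [Hd3 H3]]; auto.
  { replace 0 with (- sin 0) at 2 by (rewrite sin_0; ring). apply derivable_pt_lim_cos. }
  exists (Rmin (Rmin d1 d2) (Rmin d3 e)). split.
  { repeat apply Rmin_pos; assumption. }
  intros w Hw. rewrite Cexp_0.
  replace (w - 0)%C with w in * by ring.
  destruct w as [x y]. set (m := Cmod (x, y)) in *.
  pose proof (re_le_Cmod (x, y)) as Hx. pose proof (im_le_Cmod (x, y)) as Hy.
  fold m in Hx, Hy. unfold Re, Im in Hx, Hy; cbn [fst snd] in Hx, Hy.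
  pose proof (Rmin_l (Rmin d1 d2) (Rmin d3 e)).
  pose proof (Rmin_r (Rmin d1 d2) (Rmin d3 e)).
  pose proof (Rmin_l d1 d2). pose proof (Rmin_r d1 d2).
  pose proof (Rmin_l d3 e). pose proof (Rmin_r d3 e).
  specialize (H1 x ltac:(lra)). specialize (H2 y ltac:(lra)). specialize (H3 y ltac:(lra)).
  rewrite exp_0 in H1. rewrite sin_0 in H2. rewrite cos_0 in H3.
  pose proof (Rabs_pos x). pose proof (Rabs_pos y).
  eapply Rle_trans; [apply Cmod_le_Re_Im|].
  unfold Cexp, Cminus, Cmult, Copp, Cplus, RtoC, Re, Im; cbn [fst snd].
  replace (exp x * cos y + - (1) + - (1 * x - 0 * y))
    with ((exp x - 1 - 1 * x) * cos y + (1 + x) * (cos y - 1 - 0 * y)) by ring.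
  replace (exp x * sin y + - 0 + - (1 * y + 0 * x))
    with ((exp x - 1 - 1 * x + x) * sin y + (sin y - 0 - 1 * y)) by ring.
  assert (Hc : Rabs (cos y) <= 1) by (apply Rabs_le, COS_bound).
  assert (Hs : Rabs (sin y) <= 1) by (apply Rabs_le, SIN_bound).
  assert (Hss : Rabs (sin y) <= 2 * e).
  { replace (sin y) with ((sin y - 0 - 1 * y) + y) by ring.
    eapply Rle_trans; [apply Rabs_triang|]. nra. }
  eapply Rle_trans; [apply Rplus_le_compat; apply Rabs_triang|].
  rewrite !Rabs_mult.
  assert (Hx1 : Rabs (1 + x) <= 2).
  { eapply Rle_trans; [apply Rabs_triang|]. rewrite Rabs_R1. lra. }
  assert (Hex : Rabs (exp x - 1 - 1 * x + x) <= 2 * m).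
  { eapply Rle_trans; [apply Rabs_triang|]. nra. }
  pose proof (Rabs_pos (exp x - 1 - 1 * x)) as P1.
  pose proof (Rabs_pos (cos y - 1 - 0 * y)) as P2.
  pose proof (Rabs_pos (exp x - 1 - 1 * x + x)) as P3.
  pose proof (Rabs_pos (sin y)) as P4.
  assert (Rabs (exp x - 1 - 1 * x) <= e * m) by nra.
  assert (Rabs (cos y - 1 - 0 * y) <= e * m) by nra.
  assert (Rabs (sin y - 0 - 1 * y) <= e * m) by nra.
  assert (Rabs (exp x - 1 - 1 * x) * Rabs (cos y) <= e * m) by nra.
  assert (Rabs (1 + x) * Rabs (cos y - 1 - 0 * y) <= 2 * (e * m))
    by (apply Rmult_le_compat; try apply Rabs_pos; assumption).
  assert (Rabs (exp x - 1 - 1 * x + x) * Rabs (sin y) <= 2 * m * (2 * e))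
    by (apply Rmult_le_compat; assumption).
  nra.
Qed.

Lemma Cder_eq (f : C -> C) (z a b : C) : Cder f z a -> a = b -> Cder f z b.
Proof. intros H <-. exact H. Qed.

Lemma Cder_Cexp (z : C) : Cder Cexp z (Cexp z).
Proof.
  apply Cder_ext_loc with (f := fun w => (Cexp z * Cexp (w + - z))%C) (delta := 1).
  - lra.
  - intros w _. rewrite <- Cexp_plus. f_equal. ring.
  - eapply Cder_eq.
    + apply (Cder_mult (fun _ => Cexp z) (fun w => Cexp (w + - z))).
      * apply Cder_const.
      * apply (Cder_comp Cexp (fun w => w + - z)%C).
        -- replace (z + - z)%C with (RtoC 0) by ring. apply Cder_Cexp_0.
        -- apply (Cder_plus (fun w => w) (fun _ => (- z)%C)); [apply Cder_id|apply Cder_const].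
    + ring.
Qed.

(** * Principal argument and logarithm *)

Lemma atan_cos_sin (x : R) :
  cos (2 * atan x) = (1 - x * x) / (1 + x * x) /\ sin (2 * atan x) = 2 * x / (1 + x * x).
Proof.
  assert (Hx : 0 < 1 + x * x) by nra.
  rewrite cos_2a, sin_2a, cos_atan, sin_atan.
  assert (E : sqrt (1 + x²) * sqrt (1 + x²) = 1 + x * x).
  { apply sqrt_sqrt. unfold Rsqr. lra. }
  assert (P : 0 < sqrt (1 + x²)) by (apply sqrt_lt_R0; unfold Rsqr; lra).
  set (s := sqrt (1 + x²)) in *. clearbody s. rewrite <- E.
  split.
  - replace (1 - x * x) with (2 - s * s) by lra.
    replace (1 / s * (1 / s) - x / s * (x / s)) with ((1 - x * x) / (s * s)) by (field; lra).
    replace (1 - x * x) with (2 - s * s) by lra. reflexivity.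
  - field. lra.
Qed.

Lemma Carg_polar (r t : R) :
  0 < r -> - PI < t < PI -> Carg (r * cos t, r * sin t) = t.
Proof.
  intros Hr Ht.
  assert (Hm : Cmod (r * cos t, r * sin t) = r).
  { unfold Cmod; cbn [fst snd].
    replace ((r * cos t) ^ 2 + (r * sin t) ^ 2) with (Rsqr r).
    - apply sqrt_Rsqr; lra.
    - pose proof (sin2_cos2 t) as H. unfold Rsqr in *.
      replace (r * r) with (r * r * (sin t * sin t + cos t * cos t)) by (rewrite H; ring).
      ring. }
  unfold Carg. rewrite Hm. unfold Re, Im; cbn [fst snd].
  replace (r * cos t / r) with (cos t) by (field; lra).
  destruct (Rle_lt_dec 0 t) as [H0|H0].
  - assert (0 <= sin t) by (apply sin_ge_0; lra).
    destruct (Rle_dec 0 (r * sin t)) as [_|C]; [|exfalso; apply C; nra].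
    apply acos_cos; lra.
  - assert (sin t < 0) by (apply sin_lt_0_var; lra).
    destruct (Rle_dec 0 (r * sin t)) as [C|_]; [exfalso; nra|].
    rewrite <- cos_neg, acos_cos by lra. ring.
Qed.

Lemma Clog_Cexp (z : C) : - PI < Im z < PI -> Clog (Cexp z) = z.
Proof.
  intros H. unfold Clog. rewrite Cmod_Cexp, ln_exp. unfold Cexp.
  rewrite Carg_polar by (auto using exp_pos). destruct z; reflexivity.
Qed.

(** The half-angle formula [tan (t/2) = sin t/(1 + cos t)]. The definition by [acos] changes branch
    on the real axis; this single expression holds on the plane slit along the closed negative axis,
    so continuity of [Carg] can be read off from it. *)
Lemma Carg_atan (z : C) :
  0 < Cmod z + Re z -> Carg z = 2 * atan (Im z / (Cmod z + Re z)).
Proof.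
  intros H.
  assert (Hm : 0 < Cmod z).
  { pose proof (re_le_Cmod z) as H1. pose proof (Rle_abs (Re z)). lra. }
  pose proof (Cmod_sq z) as Hs.
  pose proof (atan_bound (Im z / (Cmod z + Re z))) as Hb.
  destruct (atan_cos_sin (Im z / (Cmod z + Re z))) as [Ec Es].
  set (t := 2 * atan (Im z / (Cmod z + Re z))) in *.
  replace z with (Cmod z * cos t, Cmod z * sin t).
  - apply Carg_polar; [assumption|]. unfold t. lra.
  - destruct z as [x y]. unfold Re, Im in *; cbn [fst snd] in *.
    set (m := Cmod (x, y)) in *. clearbody t m.
    assert (E2 : (m + x) * (m + x) + y * y = 2 * m * (m + x)).
    { replace (y * y) with (m * m - x * x) by lra. ring. }
    assert (E3 : 1 + y / (m + x) * (y / (m + x)) = 2 * m / (m + x)).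
    { replace (1 + y / (m + x) * (y / (m + x)))
        with (((m + x) * (m + x) + y * y) / ((m + x) * (m + x))) by (field; lra).
      rewrite E2. field. lra. }
    rewrite E3 in Ec, Es.
    replace (1 - y / (m + x) * (y / (m + x))) with (2 - 2 * m / (m + x)) in Ec by lra.
    f_equal.
    + rewrite Ec. field. lra.
    + rewrite Es. field. lra.
Qed.

Notation C_top := (AbsRing_UniformSpace C_AbsRing).
Notation Ccontinuous f z :=
  (continuous (T := C_top) (U := R_UniformSpace) f z).

Lemma Ccontinuous_eps (f : C -> R) (z : C) :
  Ccontinuous f z <->
  forall eps, 0 < eps -> exists delta, 0 < delta /\
    forall w, Cmod (w - z) < delta -> Rabs (f w - f z) < eps.
Proof.
  split.
  - intros H eps He.
    destruct (H (fun y => Rabs (y - f z) < eps)) as [d Hd].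
    { exists (mkposreal eps He). intros y Hy. exact Hy. }
    exists d. split; [apply cond_pos|]. intros w Hw. apply Hd. exact Hw.
  - intros H P [eps HP]. destruct (H eps (cond_pos eps)) as [d [Hd0 Hd]].
    exists (mkposreal d Hd0). intros w Hw. apply HP. apply Hd. exact Hw.
Qed.

Lemma continuous_1_lipschitz (f : C -> R) :
  (forall z w, Rabs (f w - f z) <= Cmod (w - z)) ->
  forall z, Ccontinuous f z.
Proof.
  intros H z. apply Ccontinuous_eps. intros eps He. exists eps.
  split; [assumption|]. intros w Hw. eapply Rle_lt_trans; [apply H|exact Hw].
Qed.

Lemma continuous_Re (z : C) : Ccontinuous Re z.
Proof.
  apply continuous_1_lipschitz. clear z. intros z w.
  apply (re_le_Cmod (w - z)).
Qed.

Lemma continuous_Im (z : C) : Ccontinuous Im z.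
Proof.
  apply continuous_1_lipschitz. clear z. intros z w.
  apply (im_le_Cmod (w - z)).
Qed.

Lemma continuous_Cmod (z : C) : Ccontinuous Cmod z.
Proof.
  apply continuous_1_lipschitz. clear z. intros z w. apply Rabs_le.
  pose proof (Cmod_triangle (w - z) z) as H1. replace (w - z + z)%C with w in H1 by ring.
  pose proof (Cmod_triangle (- (w - z)) w) as H2. rewrite Cmod_opp in H2.
  replace (- (w - z) + w)%C with z in H2 by ring. lra.
Qed.

Lemma continuous_Carg (z : C) : 0 < Cmod z + Re z -> Ccontinuous Carg z.
Proof.
  intros Hz.
  assert (Hs : Ccontinuous (fun w => Cmod w + Re w) z).
  { apply (continuous_plus (U := C_top) (V := R_NormedModule) Cmod Re);
      [apply continuous_Cmod|apply continuous_Re]. }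
  apply (continuous_ext_loc (T := C_top) (U := R_UniformSpace)
           _ (fun w => 2 * atan (Im w / (Cmod w + Re w)))).
  - apply Ccontinuous_eps with (eps := Cmod z + Re z) in Hs; [|assumption].
    destruct Hs as [d [Hd0 Hd]]. exists (mkposreal d Hd0). intros w Hw.
    symmetry. apply Carg_atan. specialize (Hd w Hw). apply Rabs_def2 in Hd. lra.
  - apply (continuous_scal_r (U := C_top) (V := R_NormedModule) 2
             (fun w => atan (Im w / (Cmod w + Re w)))).
    apply (continuous_comp (U := C_top) (V := R_UniformSpace) (W := R_UniformSpace)
             (fun w => Im w / (Cmod w + Re w)) atan).
    + apply (continuous_mult (U := C_top) (K := R_AbsRing) Im (fun w => / (Cmod w + Re w))).
      * apply continuous_Im.
      * apply (continuous_comp (U := C_top) (V := R_UniformSpace) (W := R_UniformSpace)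
                 (fun w => Cmod w + Re w) Rinv); [exact Hs|].
        apply continuous_Rinv. lra.
    + apply continuity_pt_filterlim, derivable_continuous_pt, derivable_pt_atan.
Qed.

(** Differentiation of an inverse function: [Clog] is continuous at [z] and [Cexp] undoes it, so the
    expansion of [Cexp] at [Clog z] can be solved for the increment of [Clog]. *)
Lemma Cder_Clog (z : C) : 0 < Cmod z + Re z -> Cder Clog z (/ z)%C.
Proof.
  intros Hz.
  assert (Hm : 0 < Cmod z).
  { pose proof (re_le_Cmod z) as H1. pose proof (Rle_abs (Re z)). lra. }
  assert (Hz0 : z <> RtoC 0) by (apply Cmod_gt_0; assumption).
  assert (Hcont : forall eps, 0 < eps -> exists delta, 0 < delta /\
    forall w, Cmod (w - z) < delta -> Cmod (Clog w - Clog z) < eps).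
  { intros eps He.
    pose proof (continuous_Carg z Hz) as Ha.
    assert (Hl : Ccontinuous (fun w => ln (Cmod w)) z).
    { apply (continuous_comp (U := C_top) (V := R_UniformSpace) (W := R_UniformSpace) Cmod ln);
        [apply continuous_Cmod|].
      apply continuity_pt_filterlim, derivable_continuous_pt.
      exists (/ Cmod z). apply derivable_pt_lim_ln. assumption. }
    apply Ccontinuous_eps with (eps := eps / 2) in Ha; [|lra].
    apply Ccontinuous_eps with (eps := eps / 2) in Hl; [|lra].
    destruct Ha as [d1 [Hd1 H1]], Hl as [d2 [Hd2 H2]].
    exists (Rmin d1 d2). split; [apply Rmin_pos; assumption|].
    intros w Hw. pose proof (Rmin_l d1 d2). pose proof (Rmin_r d1 d2).
    specialize (H1 w ltac:(lra)). specialize (H2 w ltac:(lra)).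
    eapply Rle_lt_trans; [apply Cmod_le_Re_Im|].
    cbn. unfold Rminus in *. lra. }
  pose proof (Cder_Cexp (Clog z)) as HE. rewrite Cexp_Clog in HE by assumption.
  rewrite Cder_eps in HE. rewrite Cder_eps. intros eps He.
  set (m := Cmod z) in *.
  (* With [k] and [h] the increments of [Clog] and of the point, [|h - z k| <= e |k|]. The bound
     [m/2] gives [m |k| <= 2 |h|]; the other then gives [e |k| <= eps m |h|]. *)
  set (e := Rmin (m / 2) (eps * m * m / 2)).
  assert (He0 : 0 < e).
  { apply Rmin_pos; [lra|]. apply Rdiv_lt_0_compat; [|lra].
    repeat apply Rmult_lt_0_compat; assumption. }
  assert (He1 : e <= m / 2) by apply Rmin_l.
  assert (He2 : e <= eps * m * m / 2) by apply Rmin_r.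
  clearbody e.
  destruct (HE e He0) as [d1 [Hd1 H1]]. destruct (Hcont d1 Hd1) as [d2 [Hd2 H2]].
  exists (Rmin d2 m). split; [apply Rmin_pos; assumption|].
  intros w Hw. pose proof (Rmin_l d2 m). pose proof (Rmin_r d2 m).
  assert (Hw0 : w <> RtoC 0).
  { intros ->. replace (0 - z)%C with (- z)%C in Hw by ring. rewrite Cmod_opp in Hw.
    fold m in Hw. lra. }
  specialize (H2 w ltac:(lra)). specialize (H1 (Clog w) H2).
  rewrite !Cexp_Clog in H1 by assumption.
  set (k := (Clog w - Clog z)%C) in *. set (h := (w - z)%C) in *.
  replace (k - / z * h)%C with (- (/ z * (h - z * k)))%C by (field; assumption).
  rewrite Cmod_opp, Cmod_mult, Cmod_inv by assumption. fold m.
  assert (Hk : Cmod k * m <= 2 * Cmod h).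
  { assert (T : Cmod (z * k) <= Cmod h + Cmod (h - z * k)).
    { pose proof (Cmod_triangle h (- (h - z * k))) as T. rewrite Cmod_opp in T.
      replace (h + - (h - z * k))%C with (z * k)%C in T by ring. exact T. }
    rewrite Cmod_mult in T. fold m in T. pose proof (Cmod_ge_0 k). nra. }
  apply Rmult_le_reg_l with m; [assumption|].
  rewrite <- Rmult_assoc, Rinv_r, Rmult_1_l by lra.
  eapply Rle_trans; [exact H1|].
  pose proof (Cmod_ge_0 k). pose proof (Cmod_ge_0 h).
  apply Rle_trans with (eps * m / 2 * (Cmod k * m)); [nra|].
  assert (0 < eps * m) by nra.
  apply Rle_trans with (eps * m / 2 * (2 * Cmod h)); [apply Rmult_le_compat_l; lra|].
  lra.
Qed.

(** The second derivative is asked for at [z] alone, since the Laplacian of [|f|^2] is evaluated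
    only there. The notion passes through products and compositions, as needed for [q] followed by a
    power, a Moebius map and the change to logarithmic coordinates. *)
Definition Cder2 (f : C -> C) (z : C) : Prop :=
  exists (f1 : C -> C) (delta : R), 0 < delta /\
    (forall w, Cmod (w - z) < delta -> Cder f w (f1 w)) /\
    exists f2, Cder f1 z f2.

Lemma Cder2_Cder (f : C -> C) (z : C) : Cder2 f z -> exists d, Cder f z d.
Proof.
  intros (f1 & d & Hd & H & _). exists (f1 z). apply H.
  replace (z - z)%C with (RtoC 0) by ring. rewrite Cmod_0. exact Hd.
Qed.

Lemma Cder2_const (a z : C) : Cder2 (fun _ => a) z.
Proof.
  exists (fun _ => RtoC 0), 1. split; [lra|]. split.
  - intros. apply Cder_const.
  - exists (RtoC 0). apply Cder_const.
Qed.

Lemma Cder2_id (z : C) : Cder2 (fun w => w) z.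
Proof.
  exists (fun _ => RtoC 1), 1. split; [lra|]. split.
  - intros. apply Cder_id.
  - exists (RtoC 0). apply Cder_const.
Qed.

Lemma Cder2_plus (f g : C -> C) (z : C) :
  Cder2 f z -> Cder2 g z -> Cder2 (fun w => f w + g w)%C z.
Proof.
  intros (f1 & d & Hd & Hf & f2 & Hf2) (g1 & e & He & Hg & g2 & Hg2).
  exists (fun w => f1 w + g1 w)%C, (Rmin d e). split; [apply Rmin_pos; assumption|]. split.
  - intros w Hw. pose proof (Rmin_l d e). pose proof (Rmin_r d e).
    apply Cder_plus; [apply Hf|apply Hg]; lra.
  - exists (f2 + g2)%C. apply Cder_plus; assumption.
Qed.

Lemma Cder2_mult (f g : C -> C) (z : C) :
  Cder2 f z -> Cder2 g z -> Cder2 (fun w => f w * g w)%C z.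
Proof.
  intros F G. destruct (Cder2_Cder f z F) as [fz Hfz]. destruct (Cder2_Cder g z G) as [gz Hgz].
  destruct F as (f1 & d & Hd & Hf & f2 & Hf2). destruct G as (g1 & e & He & Hg & g2 & Hg2).
  exists (fun w => f1 w * g w + f w * g1 w)%C, (Rmin d e).
  split; [apply Rmin_pos; assumption|]. split.
  - intros w Hw. pose proof (Rmin_l d e). pose proof (Rmin_r d e).
    apply Cder_mult; [apply Hf|apply Hg]; lra.
  - eexists. apply (Cder_plus (fun w => f1 w * g w)%C (fun w => f w * g1 w)%C);
      apply Cder_mult; eassumption.
Qed.

Lemma Cder2_comp (f g : C -> C) (z : C) :
  Cder2 f (g z) -> Cder2 g z -> Cder2 (fun w => f (g w)) z.
Proof.
  intros F G. destruct (Cder2_Cder g z G) as [gz Hgz].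
  destruct F as (f1 & d & Hd & Hf & f2 & Hf2). destruct G as (g1 & e & He & Hg & g2 & Hg2).
  destruct (Cder_cont g z gz Hgz d Hd) as [e' [He' Hc]].
  exists (fun w => g1 w * f1 (g w))%C, (Rmin e' e).
  split; [apply Rmin_pos; assumption|]. split.
  - intros w Hw. pose proof (Rmin_l e' e). pose proof (Rmin_r e' e).
    apply (Cder_comp f g); [apply Hf, Hc|apply Hg]; lra.
  - eexists. apply Cder_mult; [eassumption|]. apply (Cder_comp f1 g); eassumption.
Qed.

Lemma Cder2_inv (z : C) : z <> RtoC 0 -> Cder2 (fun w => / w)%C z.
Proof.
  intros Hz. exists (fun w => - (1) * (/ w * / w))%C, (Cmod z).
  split; [apply Cmod_gt_0; assumption|]. split.
  - intros w Hw. assert (w <> RtoC 0).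
    { intros ->. replace (0 - z)%C with (- z)%C in Hw by ring. rewrite Cmod_opp in Hw. lra. }
    eapply Cder_eq; [apply Cder_inv; assumption|]. field. assumption.
  - eexists. apply (Cder_mult (fun _ => - (1))%C (fun w => / w * / w)%C); [apply Cder_const|].
    apply (Cder_mult (fun w => / w)%C (fun w => / w)%C); apply Cder_inv; assumption.
Qed.

Lemma Cder2_Cexp (z : C) : Cder2 Cexp z.
Proof.
  exists Cexp, 1. split; [lra|]. split; [intros; apply Cder_Cexp|].
  exists (Cexp z). apply Cder_Cexp.
Qed.

Lemma Cder2_Clog (z : C) : 0 < Cmod z + Re z -> Cder2 Clog z.
Proof.
  intros Hz.
  assert (Hz0 : z <> RtoC 0).
  { intros ->. rewrite Cmod_0 in Hz. cbn in Hz. lra. }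
  exists (fun w => / w)%C, ((Cmod z + Re z) / 2). split; [lra|]. split.
  - intros w Hw. apply Cder_Clog.
    pose proof (Cmod_triangle (- (w - z)) w) as T. rewrite Cmod_opp in T.
    replace (- (w - z) + w)%C with z in T by ring.
    pose proof (re_le_Cmod (w - z)) as H. apply Rabs_le_between in H.
    change (Re (w - z)) with (Re w - Re z) in H. lra.
  - eexists. apply Cder_inv. assumption.
Qed.

(** * Restriction to real lines *)

Lemma Cder_Re_line (f : C -> C) (a e d : C) (t : R) :
  Cder f (a + RtoC t * e)%C d ->
  derivable_pt_lim (fun s => Re (f (a + RtoC s * e)%C)) t (Re (d * e)%C).
Proof.
  intros H eps He. rewrite Cder_eps in H.
  pose proof (Cmod_ge_0 e) as Hp.
  destruct (H (eps / (2 + Cmod e))) as [delta [Hd0 Hd]].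
  { apply Rdiv_lt_0_compat; lra. }
  assert (Hd1 : 0 < delta / (1 + Cmod e)) by (apply Rdiv_lt_0_compat; lra).
  exists (mkposreal _ Hd1). cbn [pos]. intros h Hh0 Hh.
  assert (Hah : 0 < Rabs h) by (apply Rabs_pos_lt; assumption).
  assert (Hw : Cmod ((a + RtoC (t + h) * e) - (a + RtoC t * e)) = Rabs h * Cmod e).
  { replace ((a + RtoC (t + h) * e) - (a + RtoC t * e))%C with (RtoC h * e)%C
      by (rewrite RtoC_plus; ring).
    rewrite Cmod_mult, Cmod_R. reflexivity. }
  assert (Hs : Rabs h * Cmod e < delta).
  { apply Rmult_lt_compat_r with (r := 1 + Cmod e) in Hh; [|lra].
    unfold Rdiv in Hh. rewrite Rmult_assoc, Rinv_l in Hh by lra. nra. }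
  specialize (Hd (a + RtoC (t + h) * e)%C ltac:(rewrite Hw; exact Hs)).
  rewrite Hw in Hd.
  pose proof (re_le_Cmod (f (a + RtoC (t + h) * e) - f (a + RtoC t * e)
     - d * ((a + RtoC (t + h) * e) - (a + RtoC t * e)))%C) as HR.
  replace ((a + RtoC (t + h) * e) - (a + RtoC t * e))%C with (RtoC h * e)%C in HR
      by (rewrite RtoC_plus; ring).
  set (u := f (a + RtoC (t + h) * e)%C) in *. set (v := f (a + RtoC t * e)%C) in *.
  assert (E : Re (u - v - d * (RtoC h * e))%C = ((Re u - Re v) / h - Re (d * e)%C) * h).
  { replace (Re (u - v - d * (RtoC h * e))%C) with (Re u - Re v - h * Re (d * e)%C).
    - field; assumption.
    - unfold Re, Cminus, Cplus, Copp, Cmult, RtoC; cbn [fst snd]. ring. }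
  rewrite E, Rabs_mult in HR.
  replace ((a + RtoC (t + h) * e) - (a + RtoC t * e))%C with (RtoC h * e)%C in Hd
      by (rewrite RtoC_plus; ring).
  apply Rmult_lt_reg_r with (Rabs h); [assumption|].
  eapply Rle_lt_trans; [eapply Rle_trans; [exact HR|exact Hd]|].
  replace (eps / (2 + Cmod e) * (Rabs h * Cmod e))
    with (eps * Rabs h * (Cmod e / (2 + Cmod e))) by (field; lra).
  rewrite <- (Rmult_1_r (eps * Rabs h)) at 2.
  apply Rmult_lt_compat_l; [nra|].
  apply Rmult_lt_reg_r with (2 + Cmod e); [lra|].
  unfold Rdiv. rewrite Rmult_assoc, Rinv_l by lra. lra.
Qed.

Lemma Cder_Im_line (f : C -> C) (a e d : C) (t : R) :
  Cder f (a + RtoC t * e)%C d ->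
  derivable_pt_lim (fun s => Im (f (a + RtoC s * e)%C)) t (Im (d * e)%C).
Proof.
  intros H.
  assert (H1 : Cder (fun w => (- Ci) * f w)%C (a + RtoC t * e)%C ((- Ci) * d)%C).
  { eapply Cder_eq; [apply (Cder_mult (fun _ => - Ci)%C f); [apply Cder_const|exact H]|]. ring. }
  apply Cder_Re_line in H1.
  assert (E : forall u : C, Re (- Ci * u)%C = Im u).
  { intros [x y]. unfold Re, Im, Ci, Cmult, Copp; cbn [fst snd]. ring. }
  replace (Im (d * e)%C) with (Re (- Ci * d * e)%C)
    by (rewrite <- E; f_equal; ring).
  intros eps He. destruct (H1 eps He) as [delta Hd]. exists delta.
  intros h H0 Hh. rewrite <- !E. apply Hd; assumption.
Qed.

(** * The open door function in logarithmic coordinates *)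

(* [R_{alpha,c,n}] in the coordinate [zeta = log g_c], up to an additive constant,
   with [K = n alpha / (2 Re c)] and [B = |c|^2]. *)
Definition logR (alpha K B : R) (zeta : C) : C :=
  (Cexp (RtoC alpha * zeta)
   + RtoC K * (Cexp zeta + RtoC (- B) * Cexp (RtoC (- 1) * zeta)))%C.

Lemma Cder_Cexp_scal (a z : C) : Cder (fun w => Cexp (a * w)%C) z (a * Cexp (a * z))%C.
Proof.
  apply (Cder_comp Cexp (fun w => a * w)%C); [apply Cder_Cexp|].
  eapply Cder_eq; [apply (Cder_mult (fun _ => a) (fun w => w)); [apply Cder_const|apply Cder_id]|].
  ring.
Qed.

Lemma Cder_logR (alpha K B : R) (z : C) :
  Cder (logR alpha K B) z
    (RtoC alpha * Cexp (RtoC alpha * z)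
     + RtoC K * (Cexp z + RtoC B * Cexp (RtoC (- 1) * z)))%C.
Proof.
  unfold logR.
  apply (Cder_plus (fun w => Cexp (RtoC alpha * w)%C)); [apply Cder_Cexp_scal|].
  eapply Cder_eq.
  - apply (Cder_mult (fun _ => RtoC K)); [apply Cder_const|].
    apply (Cder_plus Cexp); [apply Cder_Cexp|].
    apply (Cder_mult (fun _ => RtoC (- B))); [apply Cder_const|apply Cder_Cexp_scal].
  - rewrite !RtoC_opp. ring.
Qed.

(* The Noshiro-Warschawski argument on a convex strip where [Re F' > 0]. *)
Lemma logR_monotone (alpha K B : R) (z1 z2 : C) :
  0 < alpha <= 1 -> 0 < K -> 0 <= B ->
  Rabs (Im z1) < PI / 2 -> Rabs (Im z2) <= PI / 2 -> z1 <> z2 ->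
  0 < Re (Cconj (z2 - z1) * (logR alpha K B z2 - logR alpha K B z1))%C.
Proof.
  intros Ha HK HB H1 H2 Hne. set (d := (z2 - z1)%C).
  assert (Hd : 0 < Cmod d).
  { apply Cmod_gt_0. intros E. apply Hne.
    replace z2 with (z1 + d)%C by (unfold d; ring). rewrite E. ring. }
  (* The mean value theorem for [Re (conj d F(z1 + t d))], whose derivative is
     [|d|^2 Re F'(z1 + t d)]. *)
  destruct (MVT_cor2 (fun t => Re (Cconj d * logR alpha K B (z1 + RtoC t * d)%C)%C)
    (fun t => Re (Cconj d * (RtoC alpha * Cexp (RtoC alpha * (z1 + RtoC t * d))
      + RtoC K * (Cexp (z1 + RtoC t * d)
        + RtoC B * Cexp (RtoC (- 1) * (z1 + RtoC t * d)))) * d)%C) 0 1 Rlt_0_1)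
    as [t [E Ht]].
  { intros t _. apply (Cder_Re_line (fun w => Cconj d * logR alpha K B w)%C).
    eapply Cder_eq.
    - apply (Cder_mult (fun _ => Cconj d)); [apply Cder_const|apply Cder_logR].
    - ring. }
  replace (z1 + RtoC 1 * d)%C with z2 in E by (unfold d; ring).
  replace (z1 + RtoC 0 * d)%C with z1 in E by (unfold d; ring).
  match type of E with ?l = ?r =>
    replace (Re (Cconj d * (logR alpha K B z2 - logR alpha K B z1))%C) with l
      by (unfold Re, Cminus, Cplus, Copp, Cmult; cbn [fst snd]; ring) end.
  rewrite E. clear E. rewrite Rminus_0_r, Rmult_1_r.
  set (w := (z1 + RtoC t * d)%C).
  (* Since [t < 1] and [z1] is interior, the intermediate point is in the open strip even when [z2]
     lies on an edge. *)
  assert (Hw : Rabs (Im w) < PI / 2).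
  { replace (Im w) with ((1 - t) * Im z1 + t * Im z2)
      by (unfold w, d, Im, Re, Cminus, Cplus, Copp, Cmult, RtoC; cbn [fst snd]; ring).
    apply Rabs_def2 in H1. apply Rabs_le_between in H2. apply Rabs_def1; nra. }
  clearbody w. apply Rabs_def2 in Hw.
  match goal with |- 0 < Re (Cconj d * ?A * d)%C =>
    replace (Re (Cconj d * A * d)%C) with (Cmod d * Cmod d * Re A);
      [assert (HA : 0 < Re A) | rewrite Cmod_sq;
        unfold Re, Im, Cconj, Cmult; cbn [fst snd]; ring] end.
  2:{ pose proof (Rmult_lt_0_compat _ _ Hd Hd). nra. }
  destruct w as [s th]. unfold Im in Hw; cbn [snd] in Hw.
  unfold Cexp, Re, Im, Cplus, Cmult, RtoC; cbn [fst snd].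
  replace (alpha * th + 0 * s) with (alpha * th) by ring.
  replace (-1 * th + 0 * s) with (- th) by ring. rewrite cos_neg.
  assert (C1 : 0 < cos th) by (apply cos_gt_0; lra).
  (* Here [alpha <= 1] enters: [alpha th] stays in the interval where the cosine is positive. *)
  assert (C2 : 0 < cos (alpha * th)) by (apply cos_gt_0; nra).
  pose proof (exp_pos (alpha * s - 0 * th)) as E1. pose proof (exp_pos s) as E2.
  pose proof (exp_pos (-1 * s - 0 * th)) as E3.
  ring_simplify.
  assert (0 < alpha * exp (alpha * s - 0 * th) * cos (alpha * th))
    by (repeat apply Rmult_lt_0_compat; lra).
  assert (0 < K * exp s * cos th) by (repeat apply Rmult_lt_0_compat; lra).
  assert (0 <= K * B * exp (-1 * s - 0 * th) * cos th)
    by (repeat apply Rmult_le_pos; lra).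
  lra.
Qed.

(** * Univalence of the open door function *)

Lemma disk_1_minus (z : C) : disk z -> (1 - z)%C <> RtoC 0.
Proof.
  intros Hz E. unfold disk in Hz.
  replace z with (RtoC 1) in Hz by (replace (RtoC 1) with ((1 - z) + z)%C by ring; rewrite E; ring).
  rewrite Cmod_1 in Hz. lra.
Qed.

Lemma Re_pos_neq_0 (w : C) : 0 < Re w -> w <> RtoC 0.
Proof. intros H ->. cbn in H. lra. Qed.

Lemma g_numerator_neq_0 (c z : C) : 0 < Re c -> disk z -> (c + Cconj c * z)%C <> RtoC 0.
Proof.
  intros Hc Hz E. pose proof (g_right c z Hc Hz) as H. unfold g in H. rewrite E in H.
  unfold Cdiv in H. rewrite Cmult_0_l in H. cbn in H. lra.
Qed.

Lemma RtoC_Re2 (c : C) : (c + Cconj c)%C = RtoC (2 * Re c).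
Proof.
  destruct c. unfold Cconj, Cplus, RtoC, Re; cbn [fst snd]. f_equal; ring.
Qed.

Lemma Cder_g (c z : C) :
  disk z -> Cder (g c) z (RtoC (2 * Re c) / ((1 - z) * (1 - z)))%C.
Proof.
  intros Hz. pose proof (disk_1_minus z Hz) as H1. unfold g, Cdiv.
  eapply Cder_eq.
  - apply (Cder_mult (fun w => c + Cconj c * w)%C (fun w => / (1 - w))%C).
    + apply (Cder_plus (fun _ => c)); [apply Cder_const|].
      apply (Cder_mult (fun _ => Cconj c) (fun w => w)); [apply Cder_const|apply Cder_id].
    + apply (Cder_comp (fun w => / w)%C (fun w => 1 - w)%C); [apply Cder_inv, H1|].
      apply Cder_ext_loc with (f := fun w => (1 + (- (1)) * w)%C) (delta := 1);
        [lra|intros; ring|].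
      apply (Cder_plus (fun _ => RtoC 1)); [apply Cder_const|].
      apply (Cder_mult (fun _ => - (1))%C (fun w => w)); [apply Cder_const|apply Cder_id].
  - rewrite <- RtoC_Re2. field. exact H1.
Qed.

Lemma Rfun_explicit (alpha : R) (c : C) (n : nat) (z : C) :
  0 < Re c -> disk z ->
  Rfun alpha c n z =
  (Cpower (g c z) alpha
   + RtoC 2 * RtoC (INR n) * RtoC alpha * RtoC (Re c) * z
     / ((1 - z) * (c + Cconj c * z)))%C.
Proof.
  intros Hc Hz. unfold Rfun. rewrite (is_C_derive_unique _ _ _ (Cder_g c z Hz)).
  f_equal. unfold g. rewrite RtoC_mult.
  field. split; [apply g_numerator_neq_0|apply disk_1_minus]; assumption.
Qed.

Lemma g_inj (c z w : C) : 0 < Re c -> disk z -> disk w -> g c z = g c w -> z = w.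
Proof.
  intros Hc Hz Hw E.
  pose proof (disk_1_minus z Hz) as H1. pose proof (disk_1_minus w Hw) as H2.
  assert (H3 : (c + Cconj c)%C <> RtoC 0) by (rewrite RtoC_Re2; apply Re_pos_neq_0; cbn; lra).
  assert (E2 : ((c + Cconj c) * (z - w))%C = RtoC 0).
  { transitivity ((g c z - g c w) * ((1 - z) * (1 - w)))%C.
    - unfold g. field. split; assumption.
    - rewrite E. ring. }
  replace z with (((c + Cconj c) * (z - w)) / (c + Cconj c) + w)%C by (field; exact H3).
  rewrite E2. field. exact H3.
Qed.

(** Substituting [z = (p - c)/(p + Cconj c)] with [p = g c z] splits the rational term into
    multiples of [p], [1/p] and 1. With [p = Cexp zeta] these are the two exponentials of [logR] and
    the constant subtracted here. *)
Lemma Rfun_logR (alpha : R) (c : C) (n : nat) (z : C) :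
  0 < Re c -> disk z ->
  Rfun alpha c n z =
  (logR alpha (INR n * alpha / (2 * Re c)) (Cmod c * Cmod c) (Clog (g c z))
   - Ci * RtoC (INR n * alpha * Im c / Re c))%C.
Proof.
  intros Hc Hz. rewrite Rfun_explicit by assumption.
  pose proof (g_right c z Hc Hz) as Hg. apply Re_pos_neq_0 in Hg.
  pose proof (disk_1_minus z Hz) as H1.
  pose proof (g_numerator_neq_0 c z Hc Hz) as H2.
  assert (Hc2 : RtoC (Re c) <> RtoC 0) by (apply Re_pos_neq_0; cbn; lra).
  unfold logR, Cpower.
  replace (RtoC (- 1) * Clog (g c z))%C with (- Clog (g c z))%C
    by (change (-1) with (- (1)); rewrite RtoC_opp; ring).
  rewrite Cexp_opp, Cexp_Clog by assumption.
  assert (EB : RtoC (Cmod c * Cmod c) = (c * Cconj c)%C).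
  { rewrite Cmod_sq. destruct c. unfold Re, Im, Cconj, Cmult, RtoC; cbn [fst snd]. f_equal; ring. }
  rewrite RtoC_opp, EB.
  assert (EI : (Ci * RtoC (Im c))%C = ((c - Cconj c) / 2)%C).
  { destruct c. unfold Ci, Im, Cconj, Cdiv, Cminus, Cplus, Copp, Cinv, Cmult, RtoC; cbn [fst snd].
    f_equal; field. }
  assert (ER : RtoC (Re c) = ((c + Cconj c) / 2)%C).
  { rewrite RtoC_Re2, RtoC_mult. field. }
  replace (Ci * RtoC (INR n * alpha * Im c / Re c))%C
    with (RtoC (INR n) * RtoC alpha * (Ci * RtoC (Im c)) / RtoC (Re c))%C.
  2:{ unfold Rdiv. rewrite !RtoC_mult, RtoC_inv by lra. field. assumption. }
  replace (RtoC (INR n * alpha / (2 * Re c)))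
    with (RtoC (INR n) * RtoC alpha / (2 * RtoC (Re c)))%C.
  2:{ unfold Rdiv. rewrite !RtoC_mult, RtoC_inv by lra. rewrite RtoC_mult. field. assumption. }
  rewrite EI.
  (* Once the power is abstracted and [Re c] is written through [c] and its conjugate, a rational
     identity in [c], [Cconj c], [z] is left. *)
  match goal with |- (?A + _)%C = (?A + _ - _)%C => generalize A; intros A0 end.
  rewrite ER in *. unfold g.
  assert (H3 : (c + Cconj c)%C <> RtoC 0).
  { intros E. apply Hc2. rewrite E. field. }
  field. repeat split; assumption.
Qed.

Lemma Clog_g_strip (c z : C) : 0 < Re c -> disk z -> Rabs (Im (Clog (g c z))) < PI / 2.
Proof. intros. apply Clog_Im_right, g_right; assumption. Qed.

Lemma Rfun_univalent (alpha : R) (c : C) (n : nat) :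
  0 < Re c -> 0 < alpha <= 1 -> (0 < n)%nat -> univalent_on_disk (Rfun alpha c n).
Proof.
  intros Hc Ha Hn. apply lt_INR in Hn. cbn [INR] in Hn.
  assert (HK : 0 < INR n * alpha / (2 * Re c)).
  { apply Rdiv_lt_0_compat; [apply Rmult_lt_0_compat|]; lra. }
  pose proof (Cmod_ge_0 c) as Hm. split.
  - intros z Hz.
    assert (Hd : 0 < 1 - Cmod z) by (unfold disk in Hz; lra).
    eexists. eapply Cder_ext_loc; [exact Hd| |].
    + intros w Hw. symmetry. apply Rfun_logR; [assumption|].
      unfold disk. pose proof (Cmod_triangle (w - z) z) as T.
      replace (w - z + z)%C with w in T by ring. lra.
    + apply (Cder_plus (fun w => logR alpha _ _ (Clog (g c w)))); [|apply Cder_const].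
      apply (Cder_comp _ (fun w => Clog (g c w))); [apply Cder_logR|].
      apply (Cder_comp Clog (g c)); [apply Cder_Clog|apply Cder_g, Hz].
      pose proof (g_right c z Hc Hz). pose proof (Cmod_ge_0 (g c z)). lra.
  - intros z w Hz Hw E. rewrite !Rfun_logR in E by assumption.
    apply (g_inj c); try assumption.
    rewrite <- (Cexp_Clog (g c z)), <- (Cexp_Clog (g c w))
      by (apply Re_pos_neq_0, g_right; assumption).
    (* Distinct logarithms with equal values of [logR] would make the strictly positive real part in
       [logR_monotone] zero. *)
    f_equal. apply Classical_Prop.NNPP. intros Hne.
    pose proof (logR_monotone alpha _ (Cmod c * Cmod c) _ _ Ha HK ltac:(nra)
      (Clog_g_strip c z Hc Hz) (Rlt_le _ _ (Clog_g_strip c w Hc Hw)) Hne) as HM.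
    match type of E with (?A - ?D)%C = (?B - ?D)%C =>
      assert (E2 : (B - A)%C = RtoC 0) end.
    { match type of E with (?A - ?D)%C = (?B - ?D)%C =>
        replace (B - A)%C with ((B - D) - (A - D))%C by ring end.
      rewrite E. ring. }
    rewrite E2, Cmult_0_r in HM. cbn in HM. lra.
Qed.

(** * Complex power series *)

Notation Cseries a l := (is_series (K := C_AbsRing) (V := C_NormedModule) a l).

Lemma Cseries_norm_lim (a : nat -> C) (l : C) :
  Cseries a l ->
  is_lim_seq (fun N => Cmod (sum_n (G := C_AbelianMonoid) a N)) (Cmod l).
Proof.
  intros H. eapply filterlim_comp; [exact H|].
  exact (filterlim_norm (K := C_AbsRing) (V := C_NormedModule) l).
Qed.

Lemma Cseries_Cmod_le (a : nat -> C) (d : nat -> R) (l : C) (D : R) :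
  Cseries a l -> (forall k, Cmod (a k) <= d k) -> is_series d D -> Cmod l <= D.
Proof.
  intros Ha Hle Hd. apply Cseries_norm_lim in Ha.
  refine (is_lim_seq_le _ _ (Cmod l) D _ Ha Hd).
  intros N. unfold sum_n. eapply Rle_trans; [apply (norm_sum_n_m (K := C_AbsRing) (V := C_NormedModule))|].
  apply sum_n_m_le. apply Hle.
Qed.

Lemma Cseries_terms_bounded (a : nat -> C) (l : C) :
  Cseries a l -> exists M, forall k, Cmod (a k) <= M.
Proof.
  intros Ha. apply Cseries_norm_lim in Ha.
  apply is_lim_seq_Reals in Ha.
  destruct (maj_by_pos _ (exist _ _ Ha)) as [M [HM HB]].
  exists (2 * M). intros [|k].
  - specialize (HB 0%nat). rewrite Rabs_pos_eq in HB by apply Cmod_ge_0.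
    rewrite sum_O in HB. lra.
  - pose proof (HB k) as H1. pose proof (HB (S k)) as H2.
    rewrite Rabs_pos_eq in H1, H2 by apply Cmod_ge_0.
    rewrite sum_Sn in H2.
    change (Cmod (sum_n (G := C_AbelianMonoid) a k + a (S k)) <= M) in H2.
    set (s := sum_n (G := C_AbelianMonoid) a k) in *.
    pose proof (Cmod_triangle (s + a (S k)) (- s)) as T. rewrite Cmod_opp in T.
    replace (s + a (S k) + - s)%C with (a (S k)) in T by ring. lra.
Qed.

Lemma pow_n_Cpow (z : C) (k : nat) : pow_n (K := C_Ring) z k = (z ^ k)%C.
Proof. induction k as [|k IH]; [reflexivity|]. cbn. rewrite IH. reflexivity. Qed.

Notation Cpseries b z l := (is_pseries (K := C_AbsRing) (V := C_NormedModule) b z l).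

Lemma Cpseries_Cseries (b : nat -> C) (z l : C) :
  Cpseries b z l <-> Cseries (fun k => (z ^ k * b k)%C) l.
Proof.
  split; apply (is_series_ext (K := C_AbsRing) (V := C_NormedModule)); intros k;
    rewrite <- pow_n_Cpow; reflexivity.
Qed.

(** The terms at [(1 + r)/2] are bounded, so the radius is at least that number. Working with the
    moduli of the coefficients brings in the real theory of [CV_radius] and [PS_derive]. *)
Lemma CV_radius_disk (b : nat -> C) :
  (forall z, disk z -> exists l, Cpseries b z l) ->
  forall r, 0 <= r < 1 -> Rbar_lt (Rabs r) (CV_radius (fun k => Cmod (b k))).
Proof.
  intros H r Hr. rewrite Rabs_pos_eq by lra.
  apply Rbar_lt_le_trans with ((1 + r) / 2); [cbn; lra|].
  apply CV_radius_bounded.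
  destruct (H (RtoC ((1 + r) / 2))) as [l Hl].
  { unfold disk. rewrite Cmod_R, Rabs_pos_eq; lra. }
  apply Cpseries_Cseries, Cseries_terms_bounded in Hl. destruct Hl as [M HM].
  exists M. intros k. specialize (HM k).
  rewrite Cmod_mult, Cmod_pow, Cmod_R, (Rabs_pos_eq ((1 + r) / 2)) in HM by lra.
  rewrite Rabs_pos_eq.
  - rewrite Rmult_comm. exact HM.
  - apply Rmult_le_pos; [apply Cmod_ge_0|apply pow_le; lra].
Qed.

(** A second-order Taylor remainder. The factor [(k+1)(k+2)] is not halved: in this form it is the
    coefficient that [PS_derive] produces when applied twice. *)
Lemma Cpow_expansion_bound (z w : C) (rho : R) (k : nat) :
  Cmod z <= rho -> Cmod w <= rho ->
  Cmod (w ^ S (S k) - z ^ S (S k) - RtoC (INR (S (S k))) * z ^ S k * (w - z))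
  <= INR (S k) * INR (S (S k)) * rho ^ k * (Cmod (w - z) * Cmod (w - z)).
Proof.
  intros Hz Hw. pose proof (Cmod_ge_0 z). pose proof (Cmod_ge_0 (w - z)) as Hh.
  induction k as [|k IH].
  - replace (w ^ 2 - z ^ 2 - RtoC (INR 2) * z ^ 1 * (w - z))%C with ((w - z) * (w - z))%C.
    + rewrite Cmod_mult. cbn [INR pow]. nra.
    + replace (RtoC (INR 2)) with (1 + 1)%C by (cbn [INR]; rewrite <- RtoC_plus; reflexivity).
      cbn. ring.
  - set (m := S (S k)) in *.
    (* Multiplying the remainder of order [m] by [w] leaves an error of exactly
       [m z^(m-1) (w - z)^2]. *)
    replace (w ^ S m - z ^ S m - RtoC (INR (S m)) * z ^ m * (w - z))%C
      with (w * (w ^ m - z ^ m - RtoC (INR m) * z ^ S k * (w - z))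
            + RtoC (INR m) * z ^ S k * ((w - z) * (w - z)))%C.
    2:{ rewrite (S_INR m), RtoC_plus. unfold m. rewrite !Cpow_S. ring. }
    eapply Rle_trans; [apply Cmod_triangle|].
    rewrite !Cmod_mult, Cmod_R, Cmod_pow, (Rabs_pos_eq (INR m)) by apply pos_INR.
    set (h2 := Cmod (w - z) * Cmod (w - z)) in *.
    assert (Hh2 : 0 <= h2) by (unfold h2; nra). clearbody h2.
    assert (Hr : 0 <= rho ^ k) by (apply pow_le; lra).
    assert (Hp : Cmod z ^ S k <= rho ^ S k) by (apply pow_incr; lra).
    pose proof (pos_INR (S k)) as Hk. pose proof (pos_INR m) as Hm.
    assert (H1 : Cmod w * Cmod (w ^ m - z ^ m - RtoC (INR m) * z ^ S k * (w - z))
       <= rho * (INR (S k) * INR m * rho ^ k * h2)).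
    { apply Rmult_le_compat; auto using Cmod_ge_0. }
    assert (H2 : INR m * Cmod z ^ S k * h2 <= INR m * rho ^ S k * h2).
    { apply Rmult_le_compat_r; [assumption|]. apply Rmult_le_compat_l; assumption. }
    rewrite (S_INR m).
    replace (INR (S k)) with (INR m - 1) in H1 by (unfold m; rewrite !S_INR; ring).
    cbn [pow] in *.
    assert (0 <= INR m * (rho * rho ^ k) * h2) by (repeat apply Rmult_le_pos; lra).
    nra.
Qed.

(** Termwise differentiation: the remainder is at most [M |w - z|^2], where [M] sums the twice
    differentiated series of moduli at a radius [rho] strictly between [|z|] and 1. *)
Lemma Cpseries_derive_at (b : nat -> C) (f : C -> C) (z : C) :
  (forall w, disk w -> Cpseries b w (f w)) -> disk z ->
  exists d : C, Cder f z d /\ Cpseries (fun k => RtoC (INR (S k)) * b (S k))%C z d.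
Proof.
  intros H Hz. unfold disk in *.
  set (beta := fun k => Cmod (b k)).
  pose proof (CV_radius_disk b (fun w Hw => ex_intro _ _ (H w Hw))) as HR.
  fold beta in HR. pose proof (Cmod_ge_0 z) as Hz0.
  assert (Hd : exists d : C, Cpseries (fun k => RtoC (INR (S k)) * b (S k))%C z d).
  { destruct (ex_series_le (K := C_AbsRing) (V := C_CompleteNormedModule)
      (fun k => (z ^ k * (RtoC (INR (S k)) * b (S k)))%C)
      (fun k => Cmod z ^ k * PS_derive beta k)) as [d Hd].
    - intros k.
      change (Cmod (z ^ k * (RtoC (INR (S k)) * b (S k)))
              <= Cmod z ^ k * (INR (S k) * beta (S k))).
      rewrite !Cmod_mult, Cmod_pow, Cmod_R, (Rabs_pos_eq (INR (S k))) by apply pos_INR.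
      apply Rle_refl.
    - assert (E : ex_pseries (PS_derive beta) (Cmod z)).
      { apply CV_radius_inside. rewrite CV_radius_derive. apply HR. lra. }
      revert E. apply ex_series_ext. intros k. rewrite pow_n_pow. reflexivity.
    - exists d. apply Cpseries_Cseries. exact Hd. }
  destruct Hd as [d Hd]. exists d. split; [|exact Hd].
  set (rho := (1 + Cmod z) / 2).
  assert (E2 : ex_pseries (PS_derive (PS_derive beta)) rho).
  { apply CV_radius_inside. rewrite !CV_radius_derive. apply HR. unfold rho; lra. }
  destruct E2 as [M HM].
  assert (HM0 : 0 <= M).
  { refine (is_lim_seq_le (fun _ => 0) _ 0 M _ (is_lim_seq_const 0) HM).
    intros N. unfold sum_n. rewrite <- (Rmult_0_r (INR (S N - 0))), <- sum_n_m_const.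
    apply sum_n_m_le. intros k. rewrite pow_n_pow. unfold PS_derive.
    change (0 <= rho ^ k * (INR (S k) * (INR (S (S k)) * beta (S (S k))))).
    repeat apply Rmult_le_pos; try apply pos_INR; [apply pow_le; unfold rho; lra|].
    apply Cmod_ge_0. }
  apply Cder_eps. intros eps Heps.
  exists (Rmin (rho - Cmod z) (eps / (1 + M))). split.
  { apply Rmin_pos; [unfold rho; lra|apply Rdiv_lt_0_compat; lra]. }
  intros w Hw. pose proof (Rmin_l (rho - Cmod z) (eps / (1 + M))).
  pose proof (Rmin_r (rho - Cmod z) (eps / (1 + M))).
  assert (Hwr : Cmod w <= rho).
  { pose proof (Cmod_triangle (w - z) z) as T. replace (w - z + z)%C with w in T by ring. lra. }
  pose proof (Cmod_ge_0 (w - z)) as Hh.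
  assert (HB : Cmod (f w - f z - d * (w - z)) <= M * (Cmod (w - z) * Cmod (w - z))).
  2:{ assert (Cmod (w - z) * (1 + M) <= eps).
      { apply Rmult_le_reg_r with (/ (1 + M)); [apply Rinv_0_lt_compat; lra|].
        rewrite Rmult_assoc, Rinv_r, Rmult_1_r by lra.
        change (eps * / (1 + M)) with (eps / (1 + M)). lra. }
      eapply Rle_trans; [exact HB|]. nra. }
  (* The derived series is reindexed to match the series of [f]. At [k = 0] the truncated [k - 1] is
     harmless because of the factor [INR 0]. *)
  assert (SD : Cseries (fun k => (RtoC (INR k) * z ^ (k - 1) * b k)%C) d).
  { apply (is_series_decr_1 (K := C_AbsRing) (V := C_NormedModule)).
    apply Cpseries_Cseries in Hd.
    match goal with |- is_series _ ?l => replace l with d end.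
    - revert Hd. apply (is_series_ext (K := C_AbsRing) (V := C_NormedModule)).
      intros k. replace (S k - 1)%nat with k by lia.
      change (z ^ k * (RtoC (INR (S k)) * b (S k)) = RtoC (INR (S k)) * z ^ k * b (S k))%C. ring.
    - change (d = d + - (RtoC 0 * z ^ (0 - 1) * b 0%nat))%C. ring. }
  assert (SA : Cseries (fun k => ((w ^ k - z ^ k - RtoC (INR k) * z ^ (k - 1) * (w - z)) * b k)%C)
     (f w - f z - d * (w - z))%C).
  { assert (Sw := proj1 (Cpseries_Cseries _ _ _) (H w ltac:(unfold rho in *; lra))).
    assert (Sz := proj1 (Cpseries_Cseries _ _ _) (H z Hz)).
    pose proof (is_series_minus _ _ _ _ (is_series_minus _ _ _ _ Sw Sz)
      (is_series_scal (K := C_AbsRing) (V := C_NormedModule) (w - z)%C _ _ SD)) as S.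
    replace (f w - f z - d * (w - z))%C with (f w - f z - (w - z) * d)%C by ring.
    revert S. apply (is_series_ext (K := C_AbsRing) (V := C_NormedModule)). intros k.
    change (w ^ k * b k - z ^ k * b k - (w - z) * (RtoC (INR k) * z ^ (k - 1) * b k)
      = (w ^ k - z ^ k - RtoC (INR k) * z ^ (k - 1) * (w - z)) * b k)%C. ring. }
  set (h2 := Cmod (w - z) * Cmod (w - z)) in *.
  apply (Cseries_Cmod_le _
    (* The terms of index 0 and 1 have no second-order remainder; the shift by two aligns the others
       with [PS_derive (PS_derive beta)]. *)
    (fun k => match k with S (S k) => h2 * (rho ^ k * PS_derive (PS_derive beta) k) | _ => 0 end)
    _ _ SA).
  - intros [|[|k]].
    + cbn [INR]. change (w ^ 0)%C with (RtoC 1). change (z ^ 0)%C with (RtoC 1).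
      match goal with |- Cmod ?A <= 0 => replace A with (RtoC 0) by ring end.
      rewrite Cmod_0. lra.
    + cbn [INR Nat.sub]. rewrite !Cpow_S.
      change (w ^ 0)%C with (RtoC 1). change (z ^ 0)%C with (RtoC 1).
      match goal with |- Cmod ?A <= 0 => replace A with (RtoC 0) by ring end.
      rewrite Cmod_0. lra.
    + replace (S (S k) - 1)%nat with (S k) by lia. rewrite Cmod_mult.
      pose proof (Cpow_expansion_bound z w rho k ltac:(unfold rho; lra) Hwr) as HE.
      eapply Rle_trans; [apply Rmult_le_compat_r; [apply Cmod_ge_0|exact HE]|].
      unfold PS_derive, beta. fold h2. right. ring.
  - apply is_series_decr_1. apply is_series_decr_1.
    apply (is_series_scal (K := R_AbsRing) (V := R_NormedModule) h2) in HM.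
    replace (M * h2) with (h2 * M) by ring.
    match goal with |- is_series _ ?l => replace l with (scal (V := R_NormedModule) h2 M) end.
    + revert HM. apply is_series_ext. intros k. rewrite pow_n_pow. reflexivity.
    + change (h2 * M = h2 * M + - 0 + - 0). ring.
Qed.

Lemma Cpseries_derive (b : nat -> C) (f : C -> C) :
  (forall w, disk w -> Cpseries b w (f w)) ->
  forall z, disk z -> Cder f z (C_derive f z) /\
    Cpseries (fun k => RtoC (INR (S k)) * b (S k))%C z (C_derive f z).
Proof.
  intros H z Hz. destruct (Cpseries_derive_at b f z H Hz) as [d [H1 H2]].
  rewrite (is_C_derive_unique f z d H1). split; assumption.
Qed.

Lemma disk_open (z w : C) : Cmod (w - z) < 1 - Cmod z -> disk w.
Proof.
  intros H. unfold disk. pose proof (Cmod_triangle (w - z) z) as T.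
  replace (w - z + z)%C with w in T by ring. lra.
Qed.

(** The derivative is again given by a power series on the whole disk, so termwise differentiation
    applies a second time. *)
Lemma Cpseries_Cder2 (b : nat -> C) (f : C -> C) :
  (forall w, disk w -> Cpseries b w (f w)) -> forall z, disk z -> Cder2 f z.
Proof.
  intros H z Hz. exists (C_derive f), (1 - Cmod z).
  split; [unfold disk in Hz; lra|]. split.
  - intros w Hw. apply (Cpseries_derive b f H), (disk_open z), Hw.
  - eexists. eapply Cpseries_derive; [|exact Hz].
    intros w Hw. apply (Cpseries_derive b f H w Hw).
Qed.

(** The vanishing of the coefficients below [n] is passed on to the rest of the proof as this growth
    bound at 0. *)
Lemma Cpseries_order (b : nat -> C) (f : C -> C) (n : nat) :
  (0 < n)%nat -> (forall k : nat, (0 < k < n)%nat -> b k = RtoC 0) ->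
  (forall w, disk w -> Cpseries b w (f w)) ->
  exists M, forall z, Cmod z <= / 2 -> Cmod (f z - b 0%nat) <= M * Cmod z ^ n.
Proof.
  intros Hn Hb H.
  set (beta := fun k => Cmod (b k)).
  assert (E : ex_pseries beta (/ 2)).
  { apply CV_radius_inside, CV_radius_disk; [|lra].
    intros w Hw. exists (f w). apply H, Hw. }
  (* For [k >= n] and [|z| <= 1/2] one has [|z|^k <= |z|^n (1/2)^(k-n) = 2^n |z|^n (1/2)^k]; summing
     against [|b k|] gives [2^n D]. *)
  destruct E as [D HD]. exists (2 ^ n * D). intros z Hz.
  pose proof (Cmod_ge_0 z) as Hz0.
  assert (S0 := proj1 (Cpseries_Cseries _ _ _) (H z ltac:(unfold disk; lra))).
  assert (S1 : Cseries (fun k => match k with O => RtoC 0 | _ => (z ^ k * b k)%C end)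
    (f z - b 0%nat)%C).
  { apply (is_series_decr_1 (K := C_AbsRing) (V := C_NormedModule)).
    apply (is_series_incr_1 (K := C_AbsRing) (V := C_NormedModule)
             (fun k => (z ^ k * b k)%C)).
    match goal with |- is_series _ ?l => replace l with (f z) end; [exact S0|].
    change (f z = f z - b 0%nat + - 0 + z ^ 0 * b 0%nat)%C.
    change (z ^ 0)%C with (RtoC 1). ring. }
  apply (Cseries_Cmod_le _ (fun k => 2 ^ n * Cmod z ^ n * ((/ 2) ^ k * beta k)) _ _ S1).
  - intros [|k].
    + rewrite Cmod_0. repeat apply Rmult_le_pos; try apply pow_le; try lra. apply Cmod_ge_0.
    + rewrite Cmod_mult, Cmod_pow. unfold beta.
      destruct (Nat.lt_ge_cases (S k) n) as [Hk|Hk].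
      * rewrite Hb by lia. rewrite Cmod_0. right; ring.
      * rewrite <- Rmult_assoc. apply Rmult_le_compat_r; [apply Cmod_ge_0|].
        replace (S k) with (n + (S k - n))%nat by lia.
        rewrite !pow_add.
        replace (2 ^ n * Cmod z ^ n * ((/ 2) ^ n * (/ 2) ^ (S k - n)))
          with ((2 * / 2) ^ n * (Cmod z ^ n * (/ 2) ^ (S k - n)))
          by (rewrite Rpow_mult_distr; ring).
        rewrite Rinv_r, pow1, Rmult_1_l by lra.
        apply Rmult_le_compat_l; [apply pow_le; lra|]. apply pow_incr; lra.
  - apply (is_series_scal (K := R_AbsRing) (V := R_NormedModule) (2 ^ n * Cmod z ^ n)) in HD.
    replace (2 ^ n * D * Cmod z ^ n) with (scal (V := R_NormedModule) (2 ^ n * Cmod z ^ n) D)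
      by (change (2 ^ n * Cmod z ^ n * D = 2 ^ n * D * Cmod z ^ n); ring).
    revert HD. apply is_series_ext. intros k. reflexivity.
Qed.

(** * Maxima of upper semicontinuous functions on a square *)

(** Compactness is used on a rectangle. A function on a closed disk, or on a closed subset of it, is
    extended to the square by a constant below its values; this preserves upper semicontinuity,
    though not continuity. *)
Definition square (z : C) : Prop := -1 <= Re z <= 1 /\ -1 <= Im z <= 1.

(** Heine-Borel as a passage from a local to a uniform constant; [Q d w] weakens as [d] decreases,
    so finitely many constants have a common one. *)
Lemma square_compact (Q : R -> C -> Prop) :
  (forall d d' w, 0 < d' <= d -> Q d w -> Q d' w) ->
  (forall z, square z -> exists d, 0 < d /\ forall w, square w -> Cmod (w - z) < d -> Q d w) ->
  exists d, 0 < d /\ forall w, square w -> Q d w.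
Proof.
  intros Hmono Hloc.
  (* The factor 2 is there because closeness below [d] in each coordinate only gives
     [|w - z| < 2 d]. *)
  assert (Hdelta : forall z : C, exists d : posreal, square z ->
    forall w, square w -> Cmod (w - z) < 2 * d -> Q d w).
  { intros z. destruct (classic (square z)) as [Hz|Hz].
    - destruct (Hloc z Hz) as [d [Hd H]].
      assert (Hd2 : 0 < d / 2) by lra. exists (mkposreal _ Hd2). cbn [pos].
      intros _ w Hw Hwz. apply (Hmono d); [lra|]. apply H; [assumption|]. lra.
    - exists (mkposreal 1 Rlt_0_1). contradiction. }
  set (delta := fun x y => proj1_sig (constructive_indefinite_description _ (Hdelta (x, y)))).
  destruct (compactness_value_2d (-1) 1 (-1) 1 delta) as [d Hd].
  exists d. split; [apply cond_pos|]. intros [x y] Hw. apply NNPP. intros HQ.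
  destruct Hw as [Hx Hy]. unfold Re, Im in Hx, Hy; cbn [fst snd] in Hx, Hy.
  apply (Hd x y Hx Hy). intros (u & v & Hu & Hv & Hxu & Hyv & Hduv).
  apply HQ. unfold delta in *.
  destruct (constructive_indefinite_description _ (Hdelta (u, v))) as [e He].
  cbn [proj1_sig] in *.
  apply (Hmono e); [split; [apply cond_pos|assumption]|].
  apply He; [split; assumption|split; assumption|].
  eapply Rle_lt_trans; [apply Cmod_le_Re_Im|]. unfold Re, Im; cbn. unfold Rminus in *. lra.
Qed.

(** Two uses of compactness: [f <= / d] shows that the supremum [s] exists; were it not attained,
    [f <= s - d] would hold for some [d > 0]. *)
Lemma square_max_usc (f : C -> R) :
  (forall z, square z -> forall eps, 0 < eps ->
     exists delta, 0 < delta /\ forall w, Cmod (w - z) < delta -> f w < f z + eps) ->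
  exists z, square z /\ forall w, square w -> f w <= f z.
Proof.
  intros Husc.
  assert (Hbound : exists d, 0 < d /\ forall w, square w -> f w <= / d).
  { apply (square_compact (fun d w => f w <= / d)).
    - intros d d' w Hd H. eapply Rle_trans; [exact H|]. apply Rinv_le_contravar; lra.
    - intros z Hz. destruct (Husc z Hz 1 Rlt_0_1) as [delta [Hd H]].
      assert (HP : 0 < Rabs (f z) + 1) by (pose proof (Rabs_pos (f z)); lra).
      exists (Rmin delta (/ (Rabs (f z) + 1))). split.
      { apply Rmin_pos; [assumption|apply Rinv_0_lt_compat; assumption]. }
      intros w _ Hw. pose proof (Rmin_l delta (/ (Rabs (f z) + 1))).
      specialize (H w ltac:(lra)).
      apply Rle_trans with (Rabs (f z) + 1); [pose proof (Rle_abs (f z)); lra|].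
      pose proof (Rinv_le_contravar (Rmin delta (/ (Rabs (f z) + 1))) (/ (Rabs (f z) + 1)))
        as HI.
      rewrite Rinv_inv in HI. apply HI; [|apply Rmin_r].
      apply Rmin_pos; [assumption|apply Rinv_0_lt_compat; assumption]. }
  destruct Hbound as [d0 [_ Hbound]].
  destruct (completeness (fun y => exists w, square w /\ y = f w)) as [s [Hub Hlub]].
  { exists (/ d0). intros y [w [Hw ->]]. apply Hbound, Hw. }
  { exists (f (RtoC 0)), (RtoC 0). split; [|reflexivity].
    split; cbn; lra. }
  apply NNPP. intros Hno.
  assert (Hlt : forall z, square z -> f z < s).
  { intros z Hz. apply Rnot_le_lt. intros Hs. apply Hno. exists z. split; [assumption|].
    intros w Hw. eapply Rle_trans; [|exact Hs]. apply Hub. exists w. split; auto. }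
  destruct (square_compact (fun d w => f w <= s - d)) as [d [Hd Hall]].
  - intros; lra.
  - intros z Hz. pose proof (Hlt z Hz).
    destruct (Husc z Hz ((s - f z) / 2) ltac:(lra)) as [delta [Hdl H']].
    exists (Rmin delta ((s - f z) / 2)). split; [apply Rmin_pos; lra|].
    intros w _ Hw. pose proof (Rmin_l delta ((s - f z) / 2)).
    pose proof (Rmin_r delta ((s - f z) / 2)). specialize (H' w ltac:(lra)). lra.
  - assert (s <= s - d); [|lra].
    apply Hlub. intros y [w [Hw ->]]. apply Hall, Hw.
Qed.

Lemma Cmod_le_1_square (z : C) : Cmod z <= 1 -> square z.
Proof.
  intros H. pose proof (re_le_Cmod z) as H1. pose proof (im_le_Cmod z) as H2.
  apply Rabs_le_between in H1. apply Rabs_le_between in H2. split; lra.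
Qed.

(** * Jack's lemma *)

(** One-sided, because along a ray the comparison is known only inside the disk. *)
Lemma left_derivative_nonneg (u : R -> R) (l : R) :
  derivable_pt_lim u 0 l -> (forall t, t <= 0 -> u t <= u 0) -> 0 <= l.
Proof.
  intros H Hu. apply Rnot_lt_le. intros Hl.
  destruct (H (- l) ltac:(lra)) as [delta Hd]. pose proof (cond_pos delta).
  specialize (Hd (- (delta / 2)) ltac:(lra)).
  rewrite Rabs_Ropp, Rabs_pos_eq in Hd by lra. specialize (Hd ltac:(lra)).
  rewrite Rplus_0_l in Hd. apply Rabs_def2 in Hd.
  assert (0 <= (u (- (delta / 2)) - u 0) / (- (delta / 2))).
  { replace ((u (- (delta / 2)) - u 0) / (- (delta / 2)))
      with ((u 0 - u (- (delta / 2))) / (delta / 2)) by (field; lra).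
    apply Rdiv_le_0_compat; [|lra]. specialize (Hu (- (delta / 2)) ltac:(lra)). lra. }
  lra.
Qed.

(** The first derivative vanishes at 0; if [a2 > 0] it would be positive just to the right, and the
    mean value theorem would give [a t > a 0]. *)
Lemma second_derivative_at_max (a a1 : R -> R) (a2 delta : R) :
  0 < delta -> (forall t, Rabs t < delta -> derivable_pt_lim a t (a1 t)) ->
  derivable_pt_lim a1 0 a2 -> (forall t, Rabs t < delta -> a t <= a 0) -> a2 <= 0.
Proof.
  intros Hdelta H1 H2 Hmax. apply Rnot_lt_le. intros Ha2.
  assert (E : a1 0 = 0).
  { assert (H0 : derivable_pt_lim a 0 (a1 0)) by (apply H1; rewrite Rabs_R0; exact Hdelta).
    change (derive_pt a 0 (exist _ _ H0) = 0).
    apply (deriv_maximum a (- delta) delta); try lra.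
    intros x Hx Hx'. apply Hmax, Rabs_def1; lra. }
  destruct (H2 a2 Ha2) as [eta Heta]. pose proof (cond_pos eta).
  set (t := Rmin (delta / 2) (eta / 2)).
  assert (Ht : 0 < t) by (apply Rmin_pos; lra).
  assert (Ht1 : t <= delta / 2) by apply Rmin_l.
  assert (Ht2 : t <= eta / 2) by apply Rmin_r. clearbody t.
  destruct (MVT_cor2 a a1 0 t Ht) as [x [Ex Hx]].
  { intros x Hx. apply H1, Rabs_def1; lra. }
  specialize (Heta x ltac:(lra) ltac:(apply Rabs_def1; lra)).
  rewrite Rplus_0_l, E, Rminus_0_r in Heta. apply Rabs_def2 in Heta.
  assert (0 < a1 x).
  { replace (a1 x) with (a1 x / x * x) by (field; lra). apply Rmult_lt_0_compat; lra. }
  specialize (Hmax t ltac:(apply Rabs_def1; lra)). nra.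
Qed.

(** Polarised to two functions, since differentiating [|P|^2] a second time pairs [P] with its
    derivative. *)
Lemma Cmod2_line (P Q : C -> C) (a e p q : C) (t : R) :
  Cder P (a + RtoC t * e)%C p -> Cder Q (a + RtoC t * e)%C q ->
  derivable_pt_lim (fun s => Re (Cconj (P (a + RtoC s * e)%C) * Q (a + RtoC s * e)%C)%C) t
    (Re (Cconj (p * e) * Q (a + RtoC t * e)%C + Cconj (P (a + RtoC t * e)%C) * (q * e))%C).
Proof.
  intros HP HQ.
  pose proof (Cder_Re_line P a e p t HP) as A1. pose proof (Cder_Im_line P a e p t HP) as A2.
  pose proof (Cder_Re_line Q a e q t HQ) as B1. pose proof (Cder_Im_line Q a e q t HQ) as B2.
  pose proof (derivable_pt_lim_plus _ _ _ _ _ (derivable_pt_lim_mult _ _ _ _ _ A1 B1)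
    (derivable_pt_lim_mult _ _ _ _ _ A2 B2)) as D.
  intros eps He. destruct (D eps He) as [d Hd]. exists d. intros x Hx0 Hx.
  specialize (Hd x Hx0 Hx). unfold plus_fct, mult_fct in Hd.
  match goal with |- Rabs ?A < _ => match type of Hd with Rabs ?B < _ =>
    replace A with B; [exact Hd|] end end.
  unfold Re, Im, Cconj, Cmult, Cplus; cbn [fst snd]. field. assumption.
Qed.

Lemma Cmod2_Re_conj (u : C) : Re (Cconj u * u)%C = Cmod u ^ 2.
Proof.
  rewrite Cmod2_alt. destruct u. unfold Re, Im, Cconj, Cmult; cbn [fst snd]. ring.
Qed.

(** The derivative of [|P(t e)|^2] in [t]. The summand [RtoC 0] keeps the shape [a + t e] of
    [Cmod2_line]. *)
Definition line_d1 (P P1 : C -> C) (e : C) (t : R) : R :=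
  Re (Cconj (P1 (RtoC 0 + RtoC t * e) * e) * P (RtoC 0 + RtoC t * e)
      + Cconj (P (RtoC 0 + RtoC t * e)) * (P1 (RtoC 0 + RtoC t * e) * e))%C.

(* [|P|^2] has Laplacian [4 |P'|^2]; the two second derivatives below are taken
   along the real and the imaginary axis. *)
Lemma Cmod2_second_derivatives (P : C -> C) :
  Cder2 P (RtoC 0) -> exists P1 delta l1 l2, 0 < delta /\
    (forall e t, Cmod e = 1 -> Rabs t < delta ->
       derivable_pt_lim (fun s => Cmod (P (RtoC 0 + RtoC s * e)%C) ^ 2) t (line_d1 P P1 e t)) /\
    derivable_pt_lim (line_d1 P P1 1) 0 l1 /\
    derivable_pt_lim (line_d1 P P1 Ci) 0 l2 /\
    Cder P (RtoC 0) (P1 (RtoC 0)) /\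
    l1 + l2 = 4 * Cmod (P1 (RtoC 0)) ^ 2.
Proof.
  intros (P1 & delta & Hd & HP & p2 & HP1).
  assert (D0 : Cder P (RtoC 0) (P1 (RtoC 0))).
  { apply HP. replace (0 - 0)%C with (RtoC 0) by ring. rewrite Cmod_0. assumption. }
  (* For [e = 1] and [e = Ci] the square [e * e] is 1 and -1, so the terms with [p2] cancel in
     [l1 + l2]. *)
  assert (D2 : forall e : C, derivable_pt_lim (line_d1 P P1 e) 0
    (Re (Cconj (p2 * e * e) * P (RtoC 0) + Cconj (P1 (RtoC 0) * e) * (P1 (RtoC 0) * e)
        + (Cconj (P1 (RtoC 0) * e) * (P1 (RtoC 0) * e) + Cconj (P (RtoC 0)) * (p2 * e * e)))%C)).
  { intros e.
    assert (E0 : (RtoC 0 + RtoC 0 * e)%C = RtoC 0) by ring.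
    assert (C1 : Cder (fun w => P1 w * e)%C (RtoC 0 + RtoC 0 * e)%C (p2 * e)%C).
    { rewrite E0. eapply Cder_eq; [apply (Cder_mult P1 (fun _ => e)); [exact HP1|apply Cder_const]|].
      ring. }
    assert (C0 : Cder P (RtoC 0 + RtoC 0 * e)%C (P1 (RtoC 0))) by (rewrite E0; exact D0).
    pose proof (derivable_pt_lim_plus _ _ _ _ _
      (Cmod2_line (fun w => P1 w * e)%C P _ e _ _ 0 C1 C0)
      (Cmod2_line P (fun w => P1 w * e)%C _ e _ _ 0 C0 C1)) as D.
    rewrite E0 in D. unfold plus_fct in D. exact D. }
  exists P1, delta. do 2 eexists. split; [assumption|]. split; [|split; [apply D2|split; [apply D2|]]].
  - intros e t He Ht.
    assert (HC : Cder P (RtoC 0 + RtoC t * e)%C (P1 (RtoC 0 + RtoC t * e)%C)).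
    { apply HP. replace (0 + RtoC t * e - 0)%C with (RtoC t * e)%C by ring.
      rewrite Cmod_mult, He, Cmod_R, Rmult_1_r. assumption. }
    pose proof (Cmod2_line P P _ e _ _ t HC HC) as D.
    intros eps Heps. destruct (D eps Heps) as [d Hdd]. exists d. intros x Hx0 Hx.
    specialize (Hdd x Hx0 Hx). rewrite !Cmod2_Re_conj in Hdd. exact Hdd.
  - split; [assumption|].
    rewrite Cmod2_alt. destruct (P (RtoC 0)), (P1 (RtoC 0)), p2.
    unfold Re, Im, Ci, Cconj, Cmult, Cplus, RtoC; cbn [fst snd]. ring.
Qed.

(** At a maximum the second derivatives along both axes are at most 0, yet they add up to
    [4 |P'|^2 + 4 |Q'|^2]. *)
Lemma sum_Cmod2_local_max (P Q : C -> C) (q : C) (eta : R) :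
  Cder2 P (RtoC 0) -> Cder2 Q (RtoC 0) -> 0 < eta ->
  (forall w, Cmod w < eta ->
     Cmod (P w) ^ 2 + Cmod (Q w) ^ 2 <= Cmod (P (RtoC 0)) ^ 2 + Cmod (Q (RtoC 0)) ^ 2) ->
  Cder Q (RtoC 0) q -> q = RtoC 0.
Proof.
  intros HP HQ Heta Hmax Hq.
  destruct (Cmod2_second_derivatives P HP)
    as (P1 & d & l1 & l2 & Hd & HPl & HP1 & HP2 & _ & HPs).
  destruct (Cmod2_second_derivatives Q HQ)
    as (Q1 & d' & m1 & m2 & Hd' & HQl & HQ1 & HQ2 & HQ0 & HQs).
  assert (Eq : q = Q1 (RtoC 0)).
  { rewrite <- (is_C_derive_unique _ _ _ Hq). apply is_C_derive_unique, HQ0. }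
  assert (Hdir : forall (e : C) (l m : R), Cmod e = 1 ->
    derivable_pt_lim (line_d1 P P1 e) 0 l -> derivable_pt_lim (line_d1 Q Q1 e) 0 m ->
    l + m <= 0).
  { intros e l m He Hl Hm.
    pose proof (Rmin_l d d'). pose proof (Rmin_r d d').
    pose proof (Rmin_l (Rmin d d') eta). pose proof (Rmin_r (Rmin d d') eta).
    apply (second_derivative_at_max
      (fun s => Cmod (P (RtoC 0 + RtoC s * e)%C) ^ 2 + Cmod (Q (RtoC 0 + RtoC s * e)%C) ^ 2)
      (fun s => line_d1 P P1 e s + line_d1 Q Q1 e s) _ (Rmin (Rmin d d') eta)).
    - repeat apply Rmin_pos; assumption.
    - intros t Ht. apply (derivable_pt_lim_plus (fun s => Cmod (P (RtoC 0 + RtoC s * e)%C) ^ 2)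
        (fun s => Cmod (Q (RtoC 0 + RtoC s * e)%C) ^ 2)); [apply HPl|apply HQl]; auto; lra.
    - apply (derivable_pt_lim_plus (line_d1 P P1 e) (line_d1 Q Q1 e)); assumption.
    - intros t Ht. replace (0 + RtoC 0 * e)%C with (RtoC 0) by ring. apply Hmax.
      replace (0 + RtoC t * e)%C with (RtoC t * e)%C by ring.
      rewrite Cmod_mult, He, Cmod_R, Rmult_1_r. lra. }
  pose proof (Hdir _ _ _ Cmod_1 HP1 HQ1). pose proof (Hdir _ _ _ Cmod_Ci HP2 HQ2).
  rewrite Eq. apply Cmod_eq_0.
  pose proof (pow2_ge_0 (Cmod (P1 (RtoC 0)))).
  pose proof (Cmod_ge_0 (Q1 (RtoC 0))). nra.
Qed.

Lemma Cder2_Cmod_continuous (h : C -> C) (z : C) :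
  Cder2 h z -> forall eps, 0 < eps -> exists delta, 0 < delta /\
    forall w, Cmod (w - z) < delta -> Rabs (Cmod (h w) - Cmod (h z)) < eps.
Proof.
  intros H eps He. destruct (Cder2_Cder h z H) as [d Hd].
  destruct (Cder_cont h z d Hd eps He) as [delta [Hdl Hc]].
  exists delta. split; [assumption|]. intros w Hw.
  eapply Rle_lt_trans; [|apply (Hc w Hw)]. apply Rabs_le.
  pose proof (Cmod_triangle (h w - h z) (h z)) as T1.
  pose proof (Cmod_triangle (- (h w - h z)) (h w)) as T2.
  rewrite Cmod_opp in T2.
  replace (h w - h z + h z)%C with (h w) in T1 by ring.
  replace (- (h w - h z) + h w)%C with (h z) in T2 by ring. lra.
Qed.

Lemma Rexp_small (M k eps : R) : 0 <= M -> 0 < k -> 0 < eps ->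
  exists delta, 0 < delta /\ forall x, 0 < x < delta -> M * exp (k * ln x) < eps.
Proof.
  intros HM Hk He.
  assert (HQ : 0 < eps / (M + 1)) by (apply Rdiv_lt_0_compat; lra).
  exists (exp (ln (eps / (M + 1)) / k)). split; [apply exp_pos|].
  intros x [Hx0 Hx].
  apply ln_increasing in Hx; [|assumption]. rewrite ln_exp in Hx.
  assert (k * ln x < ln (eps / (M + 1))).
  { apply Rmult_lt_compat_l with (r := k) in Hx; [|assumption].
    replace (k * (ln (eps / (M + 1)) / k)) with (ln (eps / (M + 1))) in Hx by (field; lra).
    exact Hx. }
  apply exp_increasing in H. rewrite exp_ln in H by assumption.
  pose proof (exp_pos (k * ln x)).
  assert ((M + 1) * exp (k * ln x) < (M + 1) * (eps / (M + 1)))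
    by (apply Rmult_lt_compat_l; lra).
  replace ((M + 1) * (eps / (M + 1))) with eps in H1 by (field; lra). lra.
Qed.

Lemma exp_mult_INR (n : nat) (x : R) : 0 < x -> x ^ n = exp (INR n * ln x).
Proof. intros Hx. rewrite <- Rpower_pow by assumption. reflexivity. Qed.

(* Junk: [ln 0 = 0] makes the weight irrelevant at [z = 0], where [h] vanishes. *)
Definition weighted (h : C -> C) (s delta : R) (z : C) : R :=
  Cmod (h z) ^ 2 * exp (- (2 * s) * ln (Cmod z)) + delta * Cmod z ^ 2.

Lemma weighted_continuous (h : C -> C) (s delta : R) (z : C) :
  z <> RtoC 0 -> Cder2 h z -> forall eps, 0 < eps -> exists d, 0 < d /\
    forall w, Cmod (w - z) < d -> Rabs (weighted h s delta w - weighted h s delta z) < eps.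
Proof.
  intros Hz Hh. apply Ccontinuous_eps. apply Cmod_gt_0 in Hz.
  pose proof (continuous_Cmod z) as HC.
  assert (H1 : Ccontinuous (fun w => Cmod (h w)) z).
  { apply Ccontinuous_eps, Cder2_Cmod_continuous, Hh. }
  assert (Hx2 : forall x, continuous (fun y : R => y ^ 2) x).
  { intros x. apply continuity_pt_filterlim, derivable_continuous_pt.
    apply derivable_pt_pow. }
  unfold weighted.
  apply (continuous_plus (U := C_top) (V := R_NormedModule)
    (fun w => Cmod (h w) ^ 2 * exp (- (2 * s) * ln (Cmod w))) (fun w => delta * Cmod w ^ 2)).
  - apply (continuous_mult (U := C_top) (K := R_AbsRing) (fun w => Cmod (h w) ^ 2)
      (fun w => exp (- (2 * s) * ln (Cmod w)))).
    + apply (continuous_comp (U := C_top) (V := R_UniformSpace) (W := R_UniformSpace)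
        (fun w => Cmod (h w)) (fun y => y ^ 2)); [exact H1|apply Hx2].
    + apply (continuous_comp (U := C_top) (V := R_UniformSpace) (W := R_UniformSpace)
        Cmod (fun y => exp (- (2 * s) * ln y))); [exact HC|].
      apply continuity_pt_filterlim, derivable_continuous_pt.
      eexists. apply (derivable_pt_lim_comp (fun y => - (2 * s) * ln y) exp).
      * apply derivable_pt_lim_scal, derivable_pt_lim_ln, Hz.
      * apply derivable_pt_lim_exp.
  - apply (continuous_comp (U := C_top) (V := R_UniformSpace) (W := R_UniformSpace)
      Cmod (fun y => delta * y ^ 2)); [exact HC|].
    apply (continuous_scal_r (V := R_NormedModule) delta (fun y : R => y ^ 2)), Hx2.
Qed.

(** The first summand is at most [M^2 |z|^(2(n - s))], which tends to 0 because [s < n] is strict.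
    This gives upper semicontinuity at 0 once the value 0 is assigned there. *)
Lemma weighted_small_at_0 (h : C -> C) (n : nat) (s delta M rho : R) :
  0 < rho -> 0 <= delta -> s < INR n ->
  (forall z, Cmod z <= rho -> Cmod (h z) <= M * Cmod z ^ n) ->
  forall eps, 0 < eps -> exists d, 0 < d /\
    forall w, w <> RtoC 0 -> Cmod w < d -> weighted h s delta w < eps.
Proof.
  intros Hrho Hdelta Hs HM eps He.
  destruct (Rexp_small (M * M) (2 * (INR n - s)) (eps / 2)) as [d1 [Hd1 H1]]; [nra|lra|lra|].
  destruct (Rexp_small delta 2 (eps / 2)) as [d2 [Hd2 H2]]; [lra|lra|lra|].
  exists (Rmin rho (Rmin d1 d2)). split; [repeat apply Rmin_pos; assumption|].
  intros w Hw0 Hw. apply Cmod_gt_0 in Hw0.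
  pose proof (Rmin_l rho (Rmin d1 d2)). pose proof (Rmin_r rho (Rmin d1 d2)).
  pose proof (Rmin_l d1 d2). pose proof (Rmin_r d1 d2).
  specialize (H1 (Cmod w) ltac:(lra)). specialize (H2 (Cmod w) ltac:(lra)).
  specialize (HM w ltac:(lra)).
  unfold weighted. rewrite (exp_mult_INR 2 (Cmod w)) by assumption.
  replace (INR 2) with 2 by (cbn; lra).
  assert (Cmod (h w) ^ 2 <= (M * Cmod w ^ n) ^ 2).
  { apply pow_incr. split; [apply Cmod_ge_0|assumption]. }
  assert (Cmod (h w) ^ 2 * exp (- (2 * s) * ln (Cmod w))
    <= (M * Cmod w ^ n) ^ 2 * exp (- (2 * s) * ln (Cmod w))).
  { apply Rmult_le_compat_r; [left; apply exp_pos|assumption]. }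
  rewrite (exp_mult_INR n (Cmod w)) in H6 by assumption.
  replace ((M * exp (INR n * ln (Cmod w))) ^ 2 * exp (- (2 * s) * ln (Cmod w)))
    with (M * M * exp (2 * (INR n - s) * ln (Cmod w))) in H6; [lra|].
  replace (2 * (INR n - s) * ln (Cmod w))
    with (INR n * ln (Cmod w) + INR n * ln (Cmod w) + - (2 * s) * ln (Cmod w)) by ring.
  rewrite !exp_plus. ring.
Qed.

Lemma Cmod_exp_shift (z0 w : C) :
  z0 <> RtoC 0 -> ln (Cmod (z0 * Cexp w)) = ln (Cmod z0) + Re w.
Proof.
  intros H. apply Cmod_gt_0 in H.
  rewrite Cmod_mult, Cmod_Cexp, ln_mult, ln_exp by (auto using exp_pos). reflexivity.
Qed.

(* In the coordinate [z = z0 e^w] the weighted function is a sum of two squared moduli of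
   holomorphic functions, the second of which has no critical point. *)
Lemma weighted_no_local_max (h : C -> C) (s delta eta : R) (z0 : C) :
  z0 <> RtoC 0 -> 0 < delta -> Cder2 h z0 -> 0 < eta ->
  ~ (forall w, Cmod (w - z0) < eta -> weighted h s delta w <= weighted h s delta z0).
Proof.
  intros Hz0 Hdelta Hh Heta Hmax.
  (* Since [z = z0 e^w], the factor [|z|^(-s)] is [|z0|^(-s) |e^(-s w)|], the modulus of an entire
     function of [w]; no branch of a power of [z] is chosen. *)
  set (P := fun w => (h (z0 * Cexp w) * (Cexp (RtoC (- s) * w) * RtoC (exp (- s * ln (Cmod z0)))))%C).
  set (Q := fun w => (RtoC (sqrt delta) * z0 * Cexp w)%C).
  assert (E0 : (z0 * Cexp (RtoC 0))%C = z0) by (rewrite Cexp_0; ring).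
  assert (HE : Cder (fun w => z0 * Cexp w)%C (RtoC 0) z0).
  { eapply Cder_eq.
    - apply (Cder_mult (fun _ => z0) Cexp); [apply Cder_const|apply Cder_Cexp].
    - rewrite Cexp_0. ring. }
  destruct (Cder_cont _ _ _ HE eta Heta) as [eta' [Heta' Hc]]. rewrite E0 in Hc.
  assert (Hval : forall w, Cmod (P w) ^ 2 + Cmod (Q w) ^ 2 = weighted h s delta (z0 * Cexp w)%C).
  { intros w. unfold P, Q, weighted. rewrite (Cmod_exp_shift z0 w Hz0).
    rewrite !Cmod_mult, !Cmod_Cexp, !Cmod_R.
    rewrite (Rabs_pos_eq (exp _)) by (left; apply exp_pos).
    rewrite (Rabs_pos_eq (sqrt delta)) by apply sqrt_pos.
    replace (Re (RtoC (- s) * w)%C) with (- s * Re w)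
      by (unfold Re, Cmult, RtoC; cbn [fst snd]; ring).
    f_equal.
    - replace (- (2 * s) * (ln (Cmod z0) + Re w))
        with ((- s * Re w + - s * ln (Cmod z0)) + (- s * Re w + - s * ln (Cmod z0))) by ring.
      rewrite !exp_plus. ring.
    - transitivity (sqrt delta * sqrt delta * (Cmod z0 * exp (Re w)) ^ 2); [ring|].
      rewrite sqrt_sqrt by lra. reflexivity. }
  assert (Hq : Cder Q (RtoC 0) (RtoC (sqrt delta) * z0)%C).
  { eapply Cder_eq.
    - apply (Cder_mult (fun _ => (RtoC (sqrt delta) * z0)%C) Cexp);
        [apply Cder_const|apply Cder_Cexp].
    - rewrite Cexp_0. ring. }
  assert (Hq0 : (RtoC (sqrt delta) * z0)%C = RtoC 0).
  { apply (sum_Cmod2_local_max P Q _ eta'); try assumption.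
    - apply Cder2_mult; [|apply Cder2_mult; [|apply Cder2_const]].
      + apply (Cder2_comp h (fun w => z0 * Cexp w)%C); [rewrite E0; exact Hh|].
        apply Cder2_mult; [apply Cder2_const|apply Cder2_Cexp].
      + apply (Cder2_comp Cexp (fun w => RtoC (- s) * w)%C); [apply Cder2_Cexp|].
        apply Cder2_mult; [apply Cder2_const|apply Cder2_id].
    - apply Cder2_mult; [apply Cder2_const|apply Cder2_Cexp].
    - intros w Hw. rewrite !Hval, E0. apply Hmax, Hc.
      replace (w - 0)%C with w by ring. exact Hw. }
  apply (Cmult_neq_0 (RtoC (sqrt delta)) z0); [|exact Hz0|exact Hq0].
  intros E. apply RtoC_inj in E. apply sqrt_lt_R0 in Hdelta. lra.
Qed.

(** Schwarz's lemma with a real exponent [s]. If it failed, the weighted function would have a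
    maximum over the closed disk that is neither at 0, nor inside, nor on the circle. *)
Lemma schwarz_weighted (h : C -> C) (n : nat) (s M rho r : R) :
  0 < r < 1 -> 0 < rho -> s < INR n ->
  (forall z, Cmod z <= r -> Cder2 h z) -> (forall z, Cmod z <= r -> Cmod (h z) <= 1) ->
  (forall z, Cmod z <= rho -> Cmod (h z) <= M * Cmod z ^ n) ->
  forall z, z <> RtoC 0 -> Cmod z <= r ->
    Cmod (h z) ^ 2 * exp (- (2 * s) * ln (Cmod z)) <= exp (- (2 * s) * ln r).
Proof.
  intros Hr Hrho Hs Hh H1 HM z Hz Hzr. apply Rnot_lt_le. intros Hgt.
  set (B := exp (- (2 * s) * ln r)) in *.
  set (A := Cmod (h z) ^ 2 * exp (- (2 * s) * ln (Cmod z))) in *.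
  (* The value at [z] is at least [A = B + 2 delta], while on the circle [|z| = r] the function is
     at most [B + delta]. *)
  set (delta := (A - B) / 2). assert (Hdelta : 0 < delta) by (unfold delta; lra).
  assert (HB : 0 < B) by apply exp_pos.
  assert (Hpos : forall w, 0 <= weighted h s delta w).
  { intros w. unfold weighted. pose proof (pow2_ge_0 (Cmod (h w))).
    pose proof (pow2_ge_0 (Cmod w)). pose proof (exp_pos (- (2 * s) * ln (Cmod w))). nra. }
  (* The values 0 at the origin and -1 outside the disk lie below [B + delta], so a maximum point of
     [f] is in the punctured closed disk. *)
  set (f := fun w => if Rle_dec (Cmod w) r then
    (if Rlt_dec 0 (Cmod w) then weighted h s delta w else 0) else - 1).
  assert (Hfle : forall w, f w <= weighted h s delta w).
  { intros w. unfold f. specialize (Hpos w).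
    destruct (Rle_dec (Cmod w) r); [destruct (Rlt_dec 0 (Cmod w))|]; lra. }
  assert (Hfin : forall w, w <> RtoC 0 -> Cmod w <= r -> f w = weighted h s delta w).
  { intros w Hw Hwr. apply Cmod_gt_0 in Hw. unfold f.
    destruct (Rle_dec (Cmod w) r), (Rlt_dec 0 (Cmod w)); lra. }
  destruct (square_max_usc f) as [z0 [_ Hmax]].
  { intros w _ eps He. destruct (Rle_dec (Cmod w) r) as [Hw|Hw].
    - destruct (Req_dec (Cmod w) 0) as [Hw0|Hw0].
      + destruct (weighted_small_at_0 h n s delta M rho Hrho (Rlt_le _ _ Hdelta) Hs HM eps He)
          as [d [Hd Hsmall]].
        exists d. split; [assumption|]. intros u Hu.
        apply Cmod_eq_0 in Hw0. subst w. replace (u - 0)%C with u in Hu by ring.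
        assert (f (RtoC 0) = 0).
        { unfold f. rewrite Cmod_0. destruct (Rle_dec 0 r), (Rlt_dec 0 0); lra. }
        rewrite H. destruct (Req_dec (Cmod u) 0) as [Hu0|Hu0].
        * apply Cmod_eq_0 in Hu0. subst u. lra.
        * assert (u <> RtoC 0) by (intros ->; apply Hu0, Cmod_0).
          specialize (Hsmall u H0 Hu). specialize (Hfle u). lra.
      + assert (Hwn : w <> RtoC 0) by (intros ->; apply Hw0, Cmod_0).
        destruct (weighted_continuous h s delta w Hwn (Hh w Hw) eps He) as [d [Hd Hc]].
        exists d. split; [assumption|]. intros u Hu. rewrite (Hfin w Hwn Hw).
        specialize (Hc u Hu). apply Rabs_def2 in Hc. specialize (Hfle u). lra.
    - exists (Cmod w - r). split; [lra|]. intros u Hu.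
      pose proof (Cmod_triangle (- (u - w)) u) as T. rewrite Cmod_opp in T.
      replace (- (u - w) + u)%C with w in T by ring.
      unfold f. destruct (Rle_dec (Cmod u) r), (Rle_dec (Cmod w) r); lra. }
  assert (Hbig : B + delta < f z0).
  { specialize (Hmax z (Cmod_le_1_square z ltac:(lra))). rewrite (Hfin z Hz Hzr) in Hmax.
    unfold weighted in Hmax. fold A in Hmax. pose proof (pow2_ge_0 (Cmod z)).
    assert (0 <= delta * Cmod z ^ 2) by nra. unfold delta in *. lra. }
  assert (Hz0r : Cmod z0 <= r).
  { apply Rnot_lt_le. intros Hc. unfold f in Hbig. destruct (Rle_dec (Cmod z0) r); lra. }
  assert (Hz0 : z0 <> RtoC 0).
  { intros ->. unfold f in Hbig. rewrite Cmod_0 in Hbig.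
    destruct (Rle_dec 0 r), (Rlt_dec 0 0); lra. }
  destruct (Rle_lt_or_eq_dec _ _ Hz0r) as [Hlt|Heq].
  - apply (weighted_no_local_max h s delta (Rmin (r - Cmod z0) (Cmod z0)) z0); try assumption;
      [apply Hh; lra|apply Rmin_pos; [lra|apply Cmod_gt_0; assumption]|].
    intros w Hw. rewrite <- (Hfin z0) by assumption.
    pose proof (Rmin_l (r - Cmod z0) (Cmod z0)). pose proof (Rmin_r (r - Cmod z0) (Cmod z0)).
    assert (Hwr : Cmod w < r).
    { pose proof (Cmod_triangle (w - z0) z0) as T. replace (w - z0 + z0)%C with w in T by ring. lra. }
    rewrite <- Hfin; [apply Hmax, Cmod_le_1_square; lra| |lra].
    intros ->. replace (0 - z0)%C with (- z0)%C in Hw by ring. rewrite Cmod_opp in Hw. lra.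
  - rewrite (Hfin z0 Hz0 Hz0r) in Hbig. unfold weighted in Hbig. rewrite Heq in Hbig.
    fold B in Hbig. specialize (H1 z0 Hz0r).
    assert (Cmod (h z0) ^ 2 <= 1 ^ 2) by (apply pow_incr; split; [apply Cmod_ge_0|assumption]).
    assert (r ^ 2 <= 1 ^ 2) by (apply pow_incr; lra). nra.
Qed.

(** The curve [z1 e^(t e)] is the ray through [z1] for [e = 1] and the circle through [z1] for
    [e = Ci]. *)
Lemma derivable_pt_lim_Cmod2_exp (h : C -> C) (z1 d e : C) :
  Cder h z1 d ->
  derivable_pt_lim (fun t => Cmod (h (z1 * Cexp (RtoC t * e))%C) ^ 2) 0
    (2 * Re (Cconj (h z1) * (z1 * d * e))%C).
Proof.
  intros Hd.
  set (P := fun w => h (z1 * Cexp w)%C).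
  assert (HP : Cder P (RtoC 0 + RtoC 0 * e)%C (z1 * d)%C).
  { replace (0 + RtoC 0 * e)%C with (RtoC 0) by ring. eapply Cder_eq.
    - apply (Cder_comp h (fun w => z1 * Cexp w)%C).
      + rewrite Cexp_0, Cmult_1_r. exact Hd.
      + apply (Cder_mult (fun _ => z1) Cexp); [apply Cder_const|apply Cder_Cexp].
    - rewrite Cexp_0. ring. }
  pose proof (Cmod2_line P P _ e _ _ 0 HP HP) as D.
  intros eps He. destruct (D eps He) as [delta Hdelta]. exists delta.
  intros t Ht0 Ht. specialize (Hdelta t Ht0 Ht). rewrite !Cmod2_Re_conj in Hdelta.
  unfold P in Hdelta.
  replace (0 + RtoC (0 + t) * e)%C with (RtoC (0 + t) * e)%C in Hdelta by ring.
  replace (0 + RtoC 0 * e)%C with (RtoC 0 * e)%C in Hdelta by ring.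
  match goal with |- Rabs ?A < _ => match type of Hdelta with Rabs ?B < _ =>
    replace A with B; [exact Hdelta|] end end.
  f_equal. replace (z1 * Cexp (RtoC 0 * e))%C with z1
    by (replace (RtoC 0 * e)%C with (RtoC 0) by ring; rewrite Cexp_0; ring).
  unfold Re, Cconj, Cmult, Cplus; cbn [fst snd]. ring.
Qed.

Lemma jack (h : C -> C) (n : nat) (M rho : R) (z1 d : C) :
  disk z1 -> z1 <> RtoC 0 -> 0 < rho ->
  (forall z, Cmod z <= Cmod z1 -> Cder2 h z) ->
  (forall z, Cmod z <= Cmod z1 -> Cmod (h z) <= 1) ->
  (forall z, Cmod z <= rho -> Cmod (h z) <= M * Cmod z ^ n) ->
  Cmod (h z1) = 1 -> Cder h z1 d ->
  exists m, INR n <= m /\ (z1 * d)%C = (RtoC m * h z1)%C.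
Proof.
  intros Hdisk Hz1 Hrho Hh H1 HM Hh1 Hd.
  pose proof (proj1 (Cmod_gt_0 z1) Hz1) as Hr. unfold disk in Hdisk.
  (* As [|h z1| = 1], this is [z1 d / h z1]. It is real because [|h|] is maximal at [z1] along the
     circle, and at least [n] by growth along the ray. *)
  set (X := (Cconj (h z1) * (z1 * d))%C).
  assert (Etan : Im X = 0).
  { assert (D := derivable_pt_lim_Cmod2_exp h z1 d Ci Hd).
    assert (Hmax : forall t, Cmod (h (z1 * Cexp (RtoC t * Ci))%C) ^ 2
      <= Cmod (h (z1 * Cexp (RtoC 0 * Ci))%C) ^ 2).
    { intros t. replace (z1 * Cexp (RtoC 0 * Ci))%C with z1
        by (replace (RtoC 0 * Ci)%C with (RtoC 0) by ring; rewrite Cexp_0; ring).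
      rewrite Hh1. apply pow_incr. split; [apply Cmod_ge_0|]. apply H1.
      rewrite Cmod_mult, Cmod_Cexp. replace (Re (RtoC t * Ci)%C) with 0
        by (unfold Re, Ci, Cmult, RtoC; cbn [fst snd]; ring).
      rewrite exp_0. lra. }
    replace (2 * Re (Cconj (h z1) * (z1 * d * Ci))%C) with (- 2 * Im X) in D.
    2:{ unfold X, Re, Im, Ci, Cconj, Cmult; cbn [fst snd]. ring. }
    assert (P1 := left_derivative_nonneg _ _ D (fun t _ => Hmax t)).
    (* Reversing the direction on the circle gives the opposite inequality for [Im X]. *)
    assert (D0 : derivable_pt_lim (fun t => - t) 0 (- 1)).
    { apply (derivable_pt_lim_opp (fun t => t)), derivable_pt_lim_id. }
    rewrite <- Ropp_0 in D at 1.
    assert (D' := derivable_pt_lim_comp _ _ _ _ _ D0 D).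
    apply left_derivative_nonneg in D'; [lra|].
    intros t _. unfold comp. rewrite Ropp_0. apply Hmax. }
  (* For [t <= 0] Schwarz's lemma reads [|h(z1 e^t)|^2 <= e^(2 s t)], with equality at 0; comparing
     left derivatives gives [s <= Re X]. *)
  assert (Erad : forall s, s < INR n -> s <= Re X).
  { intros s Hs.
    assert (D := derivable_pt_lim_Cmod2_exp h z1 d 1 Hd).
    assert (De : derivable_pt_lim (fun t => exp ((2 * s) * t)) 0 (exp (2 * s * 0) * (2 * s * 1))).
    { apply (derivable_pt_lim_comp (fun t => (2 * s) * t) exp).
      - apply (derivable_pt_lim_scal (fun t => t)), derivable_pt_lim_id.
      - apply derivable_pt_lim_exp. }
    rewrite Rmult_0_r, exp_0 in De.
    assert (D' := derivable_pt_lim_minus _ _ _ _ _ D De).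
    apply left_derivative_nonneg in D'.
    - unfold X. replace (z1 * d * 1)%C with (z1 * d)%C in D' by ring. lra.
    - intros t Ht. unfold minus_fct.
      replace (z1 * Cexp (RtoC 0 * 1))%C with z1
        by (replace (RtoC 0 * 1)%C with (RtoC 0) by ring; rewrite Cexp_0; ring).
      rewrite Hh1, Rmult_0_r, exp_0.
      pose proof (schwarz_weighted h n s M rho (Cmod z1) (conj Hr Hdisk) Hrho Hs Hh H1 HM
        (z1 * Cexp (RtoC t * 1))%C) as HS.
      specialize (HS (Cmult_neq_0 _ _ Hz1 (Cexp_neq_0 _))).
      rewrite (Cmod_exp_shift z1 _ Hz1), Cmod_mult, Cmod_Cexp in HS.
      replace (Re (RtoC t * 1)%C) with t in HS
        by (unfold Re, Cmult, RtoC; cbn [fst snd]; ring).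
      assert (Het : exp t <= 1).
      { rewrite <- exp_0. destruct Ht as [Ht| ->]; [left; apply exp_increasing, Ht|right; reflexivity]. }
      specialize (HS ltac:(nra)).
      set (u := Cmod (h (z1 * Cexp (RtoC t * 1))%C) ^ 2) in *.
      assert (u <= exp (2 * s * t)); [|lra].
      apply (Rmult_le_compat_r (exp (2 * s * (ln (Cmod z1) + t)))) in HS; [|left; apply exp_pos].
      rewrite Rmult_assoc, <- !exp_plus in HS.
      replace (- (2 * s) * (ln (Cmod z1) + t) + 2 * s * (ln (Cmod z1) + t)) with 0 in HS by ring.
      replace (- (2 * s) * ln (Cmod z1) + 2 * s * (ln (Cmod z1) + t)) with (2 * s * t) in HS by ring.
      rewrite exp_0 in HS. lra. }
  exists (Re X). split.
  - apply Rnot_lt_le. intros Hlt. specialize (Erad ((INR n + Re X) / 2) ltac:(lra)). lra.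
  - assert (EX : RtoC (Re X) = X) by (destruct X as [x y]; cbn in Etan; subst y; reflexivity).
    rewrite EX. unfold X.
    replace (Cconj (h z1) * (z1 * d) * h z1)%C with ((h z1 * Cconj (h z1)) * (z1 * d))%C by ring.
    rewrite <- Cmod2_conj, Hh1. rewrite pow1. ring.
Qed.

(** The complement of [V] in the disk [|z| <= |z0|] is closed, so it has a point of least
    modulus. *)
Lemma first_exit (V : C -> Prop) (z0 : C) :
  disk z0 -> ~ V z0 ->
  (forall z, Cmod z <= Cmod z0 -> V z ->
     exists delta, 0 < delta /\ forall w, Cmod (w - z) < delta -> V w) ->
  exists z1, Cmod z1 <= Cmod z0 /\ ~ V z1 /\ forall z, Cmod z < Cmod z1 -> V z.
Proof.
  unfold disk. intros Hz0 HV0 Hopen.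
  (* Maximising [- |z|] over that complement; -2 lies below all these values, as [|z0| < 1]. *)
  set (f := fun z => if excluded_middle_informative (Cmod z <= Cmod z0 /\ ~ V z)
                     then - Cmod z else - 2).
  assert (Hin : forall z, Cmod z <= Cmod z0 -> ~ V z -> f z = - Cmod z).
  { intros z H1 H2. unfold f. destruct (excluded_middle_informative _); tauto. }
  assert (Hout : forall z, ~ (Cmod z <= Cmod z0 /\ ~ V z) -> f z = - 2).
  { intros z H. unfold f. destruct (excluded_middle_informative _); tauto. }
  assert (Htri : forall u w, Cmod w <= Cmod u + Cmod (u - w)).
  { intros u w. pose proof (Cmod_triangle (- (u - w)) u) as T. rewrite Cmod_opp in T.
    replace (- (u - w) + u)%C with w in T by ring. lra. }
  destruct (square_max_usc f) as [z1 [_ Hmax]].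
  { intros w _ eps He.
    destruct (classic (Cmod w <= Cmod z0 /\ ~ V w)) as [[H1 H2]|Hw].
    - exists eps. split; [assumption|]. intros u Hu. rewrite (Hin w H1 H2).
      specialize (Htri u w).
      destruct (classic (Cmod u <= Cmod z0 /\ ~ V u)) as [[H3 H4]|Hu'].
      + rewrite (Hin u H3 H4). lra.
      + rewrite (Hout u Hu'). lra.
    - assert (Hd : exists d, 0 < d /\ forall u, Cmod (u - w) < d ->
        ~ (Cmod u <= Cmod z0 /\ ~ V u)).
      { destruct (Rle_lt_dec (Cmod w) (Cmod z0)) as [Hle|Hlt].
        - destruct (Hopen w Hle) as [d [Hd H]]; [apply NNPP; tauto|].
          exists d. split; [assumption|]. intros u Hu [_ HN]. apply HN, H, Hu.
        - exists (Cmod w - Cmod z0). split; [lra|]. intros u Hu [HN _].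
          specialize (Htri u w). lra. }
      destruct Hd as [d [Hd H]]. exists d. split; [assumption|]. intros u Hu.
      rewrite (Hout w Hw), (Hout u (H u Hu)). lra. }
  assert (H0 := Hmax z0 (Cmod_le_1_square z0 ltac:(lra))).
  rewrite (Hin z0 (Rle_refl _) HV0) in H0.
  destruct (classic (Cmod z1 <= Cmod z0 /\ ~ V z1)) as [[H1 H2]|Hz1].
  2:{ rewrite (Hout z1 Hz1) in H0. lra. }
  exists z1. split; [assumption|]. split; [assumption|]. intros z Hz. apply NNPP. intros HN.
  specialize (Hmax z (Cmod_le_1_square z ltac:(lra))).
  rewrite (Hin z ltac:(lra) HN), (Hin z1 H1 H2) in Hmax. lra.
Qed.

Lemma radial_limit_le (f : C -> R) (z : C) (M : R) :
  z <> RtoC 0 -> Ccontinuous f z -> (forall w, Cmod w < Cmod z -> f w <= M) -> f z <= M.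
Proof.
  intros Hz Hf HM. apply Rnot_lt_le. intros Hlt. apply Cmod_gt_0 in Hz.
  apply Ccontinuous_eps with (eps := f z - M) in Hf; [|lra].
  destruct Hf as [d [Hd Hc]].
  set (e := Rmin (/ 2) (d / (2 * Cmod z))).
  assert (He : 0 < e) by (apply Rmin_pos; [lra|apply Rdiv_lt_0_compat; lra]).
  assert (He1 : e <= / 2) by apply Rmin_l.
  assert (He2 : e * Cmod z < d).
  { assert (e <= d / (2 * Cmod z)) by apply Rmin_r.
    apply (Rmult_le_compat_r (Cmod z)) in H; [|lra].
    replace (d / (2 * Cmod z) * Cmod z) with (d / 2) in H by (field; lra). lra. }
  clearbody e.
  specialize (HM (RtoC (1 - e) * z)%C).
  specialize (Hc (RtoC (1 - e) * z)%C).
  replace (RtoC (1 - e) * z - z)%C with (RtoC (- e) * z)%C in Hc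
    by (rewrite RtoC_minus, RtoC_opp; ring).
  rewrite Cmod_mult, Cmod_R, Rabs_Ropp, Rabs_pos_eq in Hc by lra.
  rewrite Cmod_mult, Cmod_R, Rabs_pos_eq in HM by lra.
  specialize (Hc He2). specialize (HM ltac:(nra)). apply Rabs_def2 in Hc. lra.
Qed.

Lemma Re_cos_Carg (w : C) : w <> RtoC 0 -> Re w = Cmod w * cos (Carg w).
Proof.
  intros Hw. rewrite <- (Cexp_Clog w Hw) at 1. unfold Cexp, Clog, Re, Im; cbn [fst snd].
  rewrite exp_ln; [reflexivity|]. apply Cmod_gt_0, Hw.
Qed.

Lemma Cmod_Re_pos (w : C) : w <> RtoC 0 -> 0 <= Re w -> 0 < Cmod w + Re w.
Proof. intros Hw Hr. apply Cmod_gt_0 in Hw. lra. Qed.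

Lemma Ccontinuous_comp_Cder (f : C -> R) (q : C -> C) (z d : C) :
  Cder q z d -> Ccontinuous f (q z) -> Ccontinuous (fun w => f (q w)) z.
Proof.
  intros Hq Hf. apply Ccontinuous_eps. intros eps He.
  apply Ccontinuous_eps with (eps := eps) in Hf; [|assumption].
  destruct Hf as [e1 [He1 H1]]. destruct (Cder_cont q z d Hq e1 He1) as [e2 [He2 H2]].
  exists e2. split; [assumption|]. intros w Hw. apply H1, H2, Hw.
Qed.

(** * The differential subordination *)

(** The inverse of the Moebius map [g c]: it sends the right half-plane to the disk and [c] to 0. *)
Definition ratio (c p : C) : C := ((p + - c) * / (p + Cconj c))%C.

Lemma plus_Cconj_neq_0 (c p : C) : 0 < Re c -> 0 <= Re p -> (p + Cconj c)%C <> RtoC 0.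
Proof.
  intros Hc Hp. apply Re_pos_neq_0. destruct c, p. unfold Re, Cconj, Cplus in *; cbn [fst snd] in *.
  lra.
Qed.

(** [|p + Cconj c|^2 - |p - c|^2 = 4 (Re p)(Re c)]. *)
Lemma Cmod_ratio_le_1 (c p : C) : 0 < Re c -> 0 <= Re p -> Cmod (ratio c p) <= 1.
Proof.
  intros Hc Hp. pose proof (plus_Cconj_neq_0 c p Hc Hp) as H0. unfold ratio.
  rewrite Cmod_mult, Cmod_inv by assumption.
  pose proof (proj1 (Cmod_gt_0 _) H0) as H1.
  apply Rmult_le_reg_r with (Cmod (p + Cconj c)); [assumption|].
  rewrite Rmult_assoc, Rinv_l, Rmult_1_r, Rmult_1_l by lra.
  pose proof (Cmod_sq (p + - c)) as E1. pose proof (Cmod_sq (p + Cconj c)) as E2.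
  pose proof (Cmod_ge_0 (p + - c)).
  apply Rnot_lt_le. intros Hlt.
  assert (Cmod (p + Cconj c) * Cmod (p + Cconj c) < Cmod (p + - c) * Cmod (p + - c)) by nra.
  rewrite E1, E2 in H2. destruct c as [a b], p as [x y].
  unfold Re, Im, Cconj, Cplus, Copp in *; cbn [fst snd] in *. nra.
Qed.

Lemma Cmod_ratio_eq_1 (c p : C) : 0 < Re c -> Re p = 0 -> Cmod (ratio c p) = 1.
Proof.
  intros Hc Hp. pose proof (plus_Cconj_neq_0 c p Hc ltac:(lra)) as H0. unfold ratio.
  rewrite Cmod_mult, Cmod_inv by assumption.
  pose proof (proj1 (Cmod_gt_0 _) H0) as H1.
  replace (Cmod (p + - c)) with (Cmod (p + Cconj c)); [field; lra|].
  unfold Cmod. f_equal. destruct c as [a b], p as [x y].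
  unfold Re, Im, Cconj, Cplus, Copp in *; cbn [fst snd] in *. subst x. ring.
Qed.

Lemma Cder_ratio (c p : C) :
  0 < Re c -> 0 <= Re p ->
  Cder (ratio c) p (RtoC (2 * Re c) / ((p + Cconj c) * (p + Cconj c)))%C.
Proof.
  intros Hc Hp. pose proof (plus_Cconj_neq_0 c p Hc Hp) as H0. unfold ratio.
  eapply Cder_eq.
  - apply (Cder_mult (fun w => w + - c)%C (fun w => / (w + Cconj c))%C).
    + apply (Cder_plus (fun w => w)); [apply Cder_id|apply Cder_const].
    + apply (Cder_comp (fun w => / w)%C (fun w => w + Cconj c)%C); [apply Cder_inv, H0|].
      apply (Cder_plus (fun w => w)); [apply Cder_id|apply Cder_const].
  - rewrite <- RtoC_Re2. field. exact H0.
Qed.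

Lemma Cder2_ratio (c p : C) : 0 < Re c -> 0 <= Re p -> Cder2 (ratio c) p.
Proof.
  intros Hc Hp. unfold ratio.
  apply Cder2_mult; [apply Cder2_plus; [apply Cder2_id|apply Cder2_const]|].
  apply (Cder2_comp (fun w => / w)%C (fun w => w + Cconj c)%C).
  - apply Cder2_inv, plus_Cconj_neq_0; assumption.
  - apply Cder2_plus; [apply Cder2_id|apply Cder2_const].
Qed.

Lemma Cder_Cpower (a : R) (w : C) :
  0 < Cmod w + Re w ->
  Cder (fun u => Cpower u a) w (/ w * RtoC a * Cpower w a)%C.
Proof.
  intros Hw. unfold Cpower. eapply Cder_eq.
  - apply (Cder_comp (fun u => Cexp (RtoC a * u)%C) Clog);
      [apply Cder_Cexp_scal|apply Cder_Clog, Hw].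
  - ring.
Qed.

Lemma Cder2_Cpower (a : R) (w : C) :
  0 < Cmod w + Re w -> Cder2 (fun u => Cpower u a) w.
Proof.
  intros Hw. unfold Cpower.
  apply (Cder2_comp Cexp (fun u => RtoC a * Clog u)%C); [apply Cder2_Cexp|].
  apply Cder2_mult; [apply Cder2_const|apply Cder2_Clog, Hw].
Qed.

Lemma Clog_Cpower (c : C) (alpha : R) :
  0 < Re c -> 0 < alpha <= 1 -> Clog (Cpower c alpha) = (RtoC alpha * Clog c)%C.
Proof.
  intros Hc Ha. apply Clog_Cexp. pose proof (Clog_Im_right c Hc) as H.
  apply Rabs_def2 in H. pose proof PI_RGT_0.
  replace (Im (RtoC alpha * Clog c)%C) with (alpha * Im (Clog c))
    by (unfold Im, Cmult, RtoC; cbn [fst snd]; ring). nra.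
Qed.

Lemma Cpower_Cpower_inv (c : C) (alpha : R) :
  0 < Re c -> 0 < alpha <= 1 -> Cpower (Cpower c alpha) (/ alpha) = c.
Proof.
  intros Hc Ha. unfold Cpower at 1. rewrite Clog_Cpower by assumption.
  rewrite Cmult_assoc, <- RtoC_mult, Rinv_l, Cmult_1_l by lra.
  apply Cexp_Clog, Re_pos_neq_0, Hc.
Qed.

Lemma Cpower_polar (w : C) (alpha : R) :
  Cpower w (/ alpha) =
  (exp (/ alpha * ln (Cmod w)) * cos (/ alpha * Carg w),
   exp (/ alpha * ln (Cmod w)) * sin (/ alpha * Carg w)).
Proof.
  unfold Cpower, Cexp, Clog, Cmult, RtoC, Re, Im; cbn [fst snd].
  rewrite !Rmult_0_l, Rminus_0_r, Rplus_0_r. reflexivity.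
Qed.

Lemma Re_Cpower_inv_nonneg (w : C) (alpha : R) :
  0 < alpha <= 1 -> Rabs (Carg w) <= PI * alpha / 2 -> 0 <= Re (Cpower w (/ alpha)).
Proof.
  intros Ha H. rewrite Cpower_polar. unfold Re; cbn [fst].
  apply Rmult_le_pos; [left; apply exp_pos|].
  apply Rabs_le_between in H.
  assert (E : Carg w = alpha * (/ alpha * Carg w)) by (field; lra).
  set (t := / alpha * Carg w) in *. clearbody t. rewrite E in H. clear E.
  apply cos_ge_0; nra.
Qed.

(** Near [a], [|f u| <= (1 + |d|) |u - a|]; so the order of vanishing of [q - a] at 0 passes to the
    function to which Jack's lemma is applied. *)
Lemma comp_order (f : C -> C) (q : C -> C) (a d e : C) (n : nat) (M : R) :
  Cder f a d -> f a = RtoC 0 -> q (RtoC 0) = a -> Cder q (RtoC 0) e ->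
  (forall z, Cmod z <= / 2 -> Cmod (q z - a) <= M * Cmod z ^ n) ->
  exists M' rho, 0 < rho /\
    forall z, Cmod z <= rho -> Cmod (f (q z)) <= M' * Cmod z ^ n.
Proof.
  intros Hf Hfa Hqa Hq HM. rewrite Cder_eps in Hf.
  destruct (Hf 1 Rlt_0_1) as [d1 [Hd1 H1]].
  destruct (Cder_cont q _ _ Hq d1 Hd1) as [d2 [Hd2 H2]].
  exists ((1 + Cmod d) * M), (Rmin (/ 2) (d2 / 2)). split; [apply Rmin_pos; lra|].
  intros z Hz. pose proof (Rmin_l (/ 2) (d2 / 2)). pose proof (Rmin_r (/ 2) (d2 / 2)).
  specialize (H2 z). replace (z - 0)%C with z in H2 by ring. rewrite Hqa in H2.
  specialize (H1 (q z) (H2 ltac:(lra))). rewrite Hfa in H1.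
  specialize (HM z ltac:(lra)).
  pose proof (Cmod_triangle (f (q z) - 0 - d * (q z - a)) (d * (q z - a))) as T.
  replace (f (q z) - 0 - d * (q z - a) + d * (q z - a))%C with (f (q z)) in T by ring.
  rewrite Cmod_mult in T. pose proof (Cmod_ge_0 d).
  assert ((1 + Cmod d) * Cmod (q z - a) <= (1 + Cmod d) * (M * Cmod z ^ n))
    by (apply Rmult_le_compat_l; lra).
  lra.
Qed.

(* The boundary value [q + z q'/q = (iy)^alpha + i alpha m |iy - c|^2 / (2 y Re c)], [m >= n],
   lies on the vertical half-line above (if [y > 0]) or below (if [y < 0]) a boundary point of
   [R_{alpha,c,n}(D)]. *)
Lemma boundary_value_not_in_range (alpha m y : R) (c L X w : C) (n : nat) :
  0 < Re c -> 0 < alpha <= 1 -> (0 < n)%nat -> INR n <= m ->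
  Rabs (Im L) = PI / 2 -> Cexp L = (0, y) ->
  (X * (Cexp L * RtoC (2 * Re c)) =
     RtoC (alpha * m) * ((Cexp L - c) * (Cexp L + Cconj c)))%C ->
  disk w -> (Cexp (RtoC alpha * L) + X)%C <> Rfun alpha c n w.
Proof.
  intros Hc Ha Hn Hm HL Hy HX Hw E.
  rewrite (Rfun_logR alpha c n w Hc Hw) in E.
  pose proof (Clog_g_strip c w Hc Hw) as Hz.
  set (z := Clog (g c w)) in *. clearbody z.
  apply lt_INR in Hn. cbn [INR] in Hn.
  set (K := INR n * alpha / (2 * Re c)) in *.
  assert (HK : 0 < K) by (apply Rdiv_lt_0_compat; [apply Rmult_lt_0_compat|]; lra).
  assert (Hne : z <> L) by (intros ->; lra).
  pose proof (Cmod_ge_0 c) as Hc0.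
  pose proof (logR_monotone alpha K (Cmod c * Cmod c) z L Ha HK ltac:(nra) Hz
    (Req_le _ _ HL) Hne) as HM.
  assert (Hy0 : y <> 0).
  { intros ->. apply (Cexp_neq_0 L). rewrite Hy. reflexivity. }
  (* [N = |i y - c|^2]. Since [i y + Cconj c] is minus the conjugate of [i y - c], the product in
     [HX] is [- N]. *)
  set (N := y * y - 2 * y * Im c + Cmod c * Cmod c).
  assert (HN : 0 <= N).
  { unfold N. rewrite Cmod_sq. pose proof (Rle_0_sqr (y - Im c)). unfold Rsqr in *. nra. }
  assert (Hyi : (/ Cexp L)%C = (Ci * RtoC (- / y))%C).
  { assert (E1 : (Cexp L * (Ci * RtoC (- / y)))%C = RtoC 1).
    { rewrite Hy. unfold Ci, Cmult, RtoC; cbn [fst snd]. f_equal; field; assumption. }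
    pose proof (Cexp_neq_0 L).
    transitivity (/ Cexp L * (Cexp L * (Ci * RtoC (- / y))))%C; [rewrite E1; ring|].
    field. assumption. }
  assert (HX2 : X = (Ci * RtoC (alpha * m * N / (2 * Re c * y)))%C).
  { assert (E1 : ((Cexp L - c) * (Cexp L + Cconj c))%C = RtoC (- N)).
    { unfold N. rewrite Hy, Cmod_sq. destruct c as [a b].
      unfold Re, Im, Cconj, Cmult, Cminus, Cplus, Copp, RtoC; cbn [fst snd]. f_equal; ring. }
    rewrite E1 in HX. pose proof (Cexp_neq_0 L).
    assert (Hc2 : RtoC (2 * Re c) <> RtoC 0) by (apply Re_pos_neq_0; cbn; lra).
    transitivity (X * (Cexp L * RtoC (2 * Re c)) * (/ Cexp L) * / RtoC (2 * Re c))%C.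
    - field. split; assumption.
    - rewrite HX, Hyi, <- RtoC_inv by lra.
      transitivity (Ci * RtoC (alpha * m * - N * - / y * / (2 * Re c)))%C.
      + rewrite !RtoC_mult. ring.
      + do 2 f_equal. field. lra. }
  (* The signed height of the assumed value above the boundary value of [logR] at [L]. It has the
     sign of [y] or is 0, because [m >= n]. *)
  set (tau := alpha * N * (m - INR n) / (2 * Re c * y)).
  assert (ED : (logR alpha K (Cmod c * Cmod c) L - logR alpha K (Cmod c * Cmod c) z)%C
    = (Ci * RtoC (- tau))%C).
  { replace (logR alpha K (Cmod c * Cmod c) z)
      with (Cexp (RtoC alpha * L) + X + Ci * RtoC (INR n * alpha * Im c / Re c))%C
      by (rewrite E; ring).
    unfold logR.
    replace (RtoC (- 1) * L)%C with (- L)%C by (change (-1) with (- (1)); rewrite RtoC_opp; ring).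
    rewrite Cexp_opp, Hyi, HX2.
    replace (Cexp L) with (Ci * RtoC y)%C.
    2:{ rewrite Hy. unfold Ci, Cmult, RtoC; cbn [fst snd]. f_equal; ring. }
    transitivity (Ci * RtoC (K * (y + - (Cmod c * Cmod c) * - / y)
      - alpha * m * N / (2 * Re c * y) - INR n * alpha * Im c / Re c))%C.
    - rewrite !RtoC_minus, (RtoC_mult K), RtoC_plus, RtoC_mult. ring.
    - do 2 f_equal. unfold K, tau, N. field. split; lra. }
  rewrite ED in HM.
  (* Since [L] is on an edge and [z] inside, [Im L - Im z] has the sign of [Im L], which is that of
     [y]; together with [0 <= y * tau] this is contradictory. *)
  assert (HM2 : 0 < - (Im L - Im z) * tau).
  { replace (- (Im L - Im z) * tau) with (Re (Cconj (L - z) * (Ci * RtoC (- tau)))%C); [exact HM|].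
    unfold Re, Im, Ci, Cconj, Cminus, Cplus, Copp, Cmult, RtoC; cbn [fst snd]. ring. }
  assert (Hytau : 0 <= y * tau).
  { replace (y * tau) with (alpha * N * (m - INR n) / (2 * Re c)) by (unfold tau; field; lra).
    apply Rdiv_le_0_compat; [|lra]. repeat apply Rmult_le_pos; lra. }
  apply Rabs_def2 in Hz.
  assert (Hyv : y = exp (Re L) * sin (Im L)).
  { change y with (snd (0, y)). rewrite <- Hy. reflexivity. }
  pose proof (exp_pos (Re L)) as He.
  unfold Rabs in HL. destruct (Rcase_abs (Im L)).
  - replace (Im L) with (- (PI / 2)) in * by lra.
    rewrite sin_neg, sin_PI2 in Hyv. nra.
  - rewrite HL in *. rewrite sin_PI2 in Hyv. nra.
Qed.

Lemma open_door (c : C) (alpha : R) (n : nat) (q : C -> C) :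
  0 < Re c -> 0 < alpha <= 1 -> (0 < n)%nat ->
  classH (Cpower c alpha) n q ->
  (forall z : C, disk z ->
    q z <> RtoC 0 /\
    exists w : C, disk w /\
      (q z + z * C_derive q z / q z)%C = Rfun alpha c n w) ->
  forall z : C, disk z -> q z <> RtoC 0 /\ Rabs (Carg (q z)) < PI * alpha / 2.
Proof.
  intros Hc Ha Hn [_ (b & Hb0 & Hbn & Hb)] Hin z0 Hz0.
  pose proof PI_RGT_0 as HPI.
  split; [apply Hin, Hz0|].
  (* The condition on [Re] keeps [q z] off the cut of [Carg], so [V] is stable under small
     perturbations of [z]. *)
  set (V := fun z => 0 < Re (q z) /\ Rabs (Carg (q z)) < PI * alpha / 2).
  enough (HV : V z0) by apply HV. apply NNPP. intros HV.
  assert (Hder : forall z, disk z -> Cder q z (C_derive q z)).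
  { intros z Hz. apply (Cpseries_derive b q Hb z Hz). }
  assert (Hq2 : forall z, disk z -> Cder2 q z) by apply (Cpseries_Cder2 b q Hb).
  destruct (first_exit V z0 Hz0 HV) as (z1 & Hz1 & HV1 & Hinside).
  { intros z Hz [HRe HCarg]. unfold disk in Hz0.
    assert (Hzd : disk z) by (unfold disk; lra).
    assert (HS : 0 < Cmod (q z) + Re (q z)) by (pose proof (Cmod_ge_0 (q z)); lra).
    pose proof (Ccontinuous_comp_Cder Re q z _ (Hder z Hzd) (continuous_Re _)) as C1.
    pose proof (Ccontinuous_comp_Cder Carg q z _ (Hder z Hzd) (continuous_Carg _ HS)) as C2.
    apply Ccontinuous_eps with (eps := Re (q z)) in C1; [|assumption].
    apply Ccontinuous_eps with (eps := PI * alpha / 2 - Rabs (Carg (q z))) in C2; [|lra].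
    destruct C1 as [d1 [Hd1 H1]], C2 as [d2 [Hd2 H2]].
    exists (Rmin d1 d2). split; [apply Rmin_pos; assumption|].
    intros w Hw. pose proof (Rmin_l d1 d2). pose proof (Rmin_r d1 d2).
    specialize (H1 w ltac:(lra)). specialize (H2 w ltac:(lra)). split.
    - apply Rabs_def2 in H1. lra.
    - pose proof (Rabs_triang (Carg (q w) - Carg (q z)) (Carg (q z))) as T.
      replace (Carg (q w) - Carg (q z) + Carg (q z)) with (Carg (q w)) in T by ring. lra. }
  assert (Hd1 : disk z1) by (unfold disk in *; lra).
  assert (Hd0 : disk (RtoC 0)) by (unfold disk; rewrite Cmod_0; lra).
  destruct (Cpseries_order b q n Hn Hbn Hb) as [M HM]. rewrite Hb0 in HM.
  assert (Hq0 : q (RtoC 0) = Cpower c alpha).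
  { replace (q (RtoC 0)) with (q (RtoC 0) - Cpower c alpha + Cpower c alpha)%C by ring.
    rewrite (Cmod_eq_0 (q (RtoC 0) - Cpower c alpha)); [ring|].
    specialize (HM (RtoC 0)). rewrite Cmod_0, pow_i, Rmult_0_r in HM by exact Hn.
    apply Rle_antisym; [apply HM; lra|apply Cmod_ge_0]. }
  assert (HCarg0 : Carg (Cpower c alpha) = alpha * Carg c).
  { change (Carg (Cpower c alpha)) with (Im (Clog (Cpower c alpha))).
    rewrite Clog_Cpower by assumption. unfold Clog, Im, Cmult, RtoC; cbn [fst snd]. ring. }
  assert (HV0 : V (RtoC 0)).
  { pose proof (Clog_Im_right c Hc) as Hcl. unfold Clog, Im in Hcl; cbn [snd] in Hcl.
    unfold V. rewrite Hq0.
    assert (HA : Rabs (Carg (Cpower c alpha)) < PI * alpha / 2).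
    { rewrite HCarg0, Rabs_mult, (Rabs_pos_eq alpha) by lra. nra. }
    split; [|exact HA].
    rewrite Re_cos_Carg by apply Cexp_neq_0. apply Rmult_lt_0_compat.
    - apply Cmod_gt_0, Cexp_neq_0.
    - apply Rabs_def2 in HA. apply cos_gt_0; nra. }
  assert (Hz1n : z1 <> RtoC 0) by (intros ->; contradiction).
  assert (Hcd : forall z, Cmod z <= Cmod z1 -> disk z) by (unfold disk in *; intros; lra).
  assert (Hclosed : forall (f : C -> R) (K : R),
    (forall z, Cmod z <= Cmod z1 -> Ccontinuous f z) ->
    (forall z, Cmod z < Cmod z1 -> f z <= K) -> forall z, Cmod z <= Cmod z1 -> f z <= K).
  { intros f K Hf HK z [Hz|Hz]; [apply HK, Hz|].
    apply radial_limit_le.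
    - intros ->. rewrite Cmod_0 in Hz. apply Cmod_gt_0 in Hz1n. lra.
    - apply Hf. lra.
    - rewrite Hz. exact HK. }
  (* On the closed disk [Re (q z) >= 0] comes first: with [q z <> 0] it keeps [q z] off the cut, and
     only then does [Carg] pass to the limit. *)
  assert (HRe : forall z, Cmod z <= Cmod z1 -> 0 <= Re (q z)).
  { intros z Hz. enough (- Re (q z) <= 0) by lra. revert z Hz. apply Hclosed.
    - intros z Hz. apply (continuous_opp (U := C_top) (V := R_NormedModule) (fun w => Re (q w))).
      apply (Ccontinuous_comp_Cder Re q z _ (Hder z (Hcd z Hz))), continuous_Re.
    - intros z Hz. destruct (Hinside z Hz). lra. }
  assert (HS : forall z, Cmod z <= Cmod z1 -> 0 < Cmod (q z) + Re (q z)).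
  { intros z Hz. apply Cmod_Re_pos; [apply Hin, Hcd, Hz|apply HRe, Hz]. }
  assert (HCarg : forall z, Cmod z <= Cmod z1 -> Rabs (Carg (q z)) <= PI * alpha / 2).
  { apply Hclosed.
    - intros z Hz. apply (continuous_comp (U := C_top) (V := R_UniformSpace)
        (W := R_UniformSpace) (fun w => Carg (q w)) Rabs); [|apply continuous_Rabs].
      apply (Ccontinuous_comp_Cder Carg q z _ (Hder z (Hcd z Hz))), continuous_Carg, HS, Hz.
    - intros z Hz. left. apply (Hinside z Hz). }
  assert (HC1 : Rabs (Carg (q z1)) = PI * alpha / 2).
  (* A smaller argument would also force [Re (q z1) > 0], hence [V z1]. *)
  { destruct (HCarg z1 (Rle_refl _)) as [Hlt|]; [|assumption].
    exfalso. apply HV1. split; [|exact Hlt].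
    rewrite Re_cos_Carg by apply (Hin z1 Hd1). apply Rmult_lt_0_compat.
    - apply Cmod_gt_0, (Hin z1 Hd1).
    - apply Rabs_def2 in Hlt. apply cos_gt_0; nra. }
  (* [L] is a logarithm of [p(z1)] on an edge of the strip. The boundary power is written
     [Cexp (alpha L)], which is [q z1], so no branch of [(i y)^alpha] has to be chosen. *)
  set (L := (RtoC (/ alpha) * Clog (q z1))%C).
  assert (HL : Rabs (Im L) = PI / 2).
  { replace (Im L) with (/ alpha * Carg (q z1))
      by (unfold L, Im, Clog, Cmult, RtoC; cbn [fst snd]; ring).
    rewrite Rabs_mult, HC1, Rabs_pos_eq by (left; apply Rinv_0_lt_compat; lra).
    field. lra. }
  assert (HReL : Re (Cexp L) = 0).
  { unfold Cexp, Re at 1; cbn [fst]. apply Rmult_eq_0_compat_l.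
    unfold Rabs in HL. destruct (Rcase_abs (Im L)).
    - rewrite <- cos_neg, HL. apply cos_PI2.
    - rewrite HL. apply cos_PI2. }
  set (T := fun w => ratio c (Cpower w (/ alpha))).
  assert (HTder : forall z, Cmod z <= Cmod z1 -> exists d, Cder T (q z) d).
  { intros z Hz. eexists. apply (Cder_comp (ratio c) (fun w => Cpower w (/ alpha))).
    - apply Cder_ratio; [assumption|]. apply Re_Cpower_inv_nonneg; auto.
    - apply Cder_Cpower, HS, Hz. }
  assert (H0z1 : Cmod 0 <= Cmod z1) by (rewrite Cmod_0; apply Cmod_ge_0).
  destruct (HTder _ H0z1) as [dT HdT]. rewrite Hq0 in HdT.
  destruct (comp_order T q (Cpower c alpha) dT (C_derive q (RtoC 0)) n M)
    as (M' & rho & Hrho & HM'); try assumption; [|apply Hder, Hd0|].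
  { unfold T, ratio. rewrite Cpower_Cpower_inv by assumption. ring. }
  assert (HhD : Cder (fun z => T (q z)) z1
    (C_derive q z1 * (/ q z1 * RtoC (/ alpha) * Cexp L *
      (RtoC (2 * Re c) / ((Cexp L + Cconj c) * (Cexp L + Cconj c)))))%C).
  { apply (Cder_comp T q); [|apply Hder, Hd1].
    apply (Cder_comp (ratio c) (fun w => Cpower w (/ alpha))).
    - apply (Cder_ratio c (Cexp L)); [assumption|lra].
    - apply Cder_Cpower, HS, Rle_refl. }
  match type of HhD with is_derive _ _ ?d =>
    destruct (jack (fun z => T (q z)) n M' rho z1 d Hd1 Hz1n Hrho) as (m & Hm & Em);
      [| | | |exact HhD|] end.
  - intros z Hz. apply (Cder2_comp T q); [|apply Hq2, Hcd, Hz].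
    apply (Cder2_comp (ratio c) (fun w => Cpower w (/ alpha))).
    + apply Cder2_ratio; [assumption|]. apply Re_Cpower_inv_nonneg; auto.
    + apply Cder2_Cpower, HS, Hz.
  - intros z Hz. apply Cmod_ratio_le_1; [assumption|]. apply Re_Cpower_inv_nonneg; auto.
  - exact HM'.
  - apply Cmod_ratio_eq_1; assumption.
  - destruct (Hin z1 Hd1) as [Hqn [w [Hw Ew]]].
    assert (EqL : q z1 = Cexp (RtoC alpha * L)%C).
    { unfold L. rewrite Cmult_assoc, <- RtoC_mult, Rinv_r, Cmult_1_l, Cexp_Clog by (lra || assumption).
      reflexivity. }
    rewrite EqL in Ew at 1.
    apply (boundary_value_not_in_range alpha m (Im (Cexp L)) c L
      (z1 * C_derive q z1 / q z1)%C w n); try assumption.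
    + rewrite <- HReL. destruct (Cexp L); reflexivity.
    + unfold T in Em. change (Cpower (q z1) (/ alpha)) with (Cexp L) in Em.
      unfold ratio in Em.
      pose proof (plus_Cconj_neq_0 c (Cexp L) Hc ltac:(lra)) as Hp.
      assert (Han : RtoC alpha <> RtoC 0) by (apply Re_pos_neq_0; cbn; lra).
      rewrite RtoC_inv in Em by lra.
      set (p := Cexp L) in *.
      (* Jack's relation [Em] multiplied by [alpha (p + Cconj c)^2], which clears the denominators
         of the derivative of [ratio]. *)
      transitivity (RtoC alpha * ((p + Cconj c) * (p + Cconj c)) *
        (z1 * (C_derive q z1 * (/ q z1 * / RtoC alpha * p *
          (RtoC (2 * Re c) / ((p + Cconj c) * (p + Cconj c)))))))%C.
      * field. repeat split; assumption.
      * rewrite Em, RtoC_mult. field. assumption.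
Qed.

Theorem theorem1p2 (c : C) (alpha : R) (n : nat) :
  0 < Re c -> 0 < alpha <= 1 -> (0 < n)%nat ->
  (forall z : C, disk z ->
     Rfun alpha c n z =
     (Cpower ((c + Cconj c * z) / (1 - z)) alpha
      + RtoC 2 * RtoC (INR n) * RtoC alpha * RtoC (Re c) * z
        / ((1 - z) * (c + Cconj c * z)))%C) /\
  univalent_on_disk (Rfun alpha c n) /\
  (forall q : C -> C,
     classH (Cpower c alpha) n q ->
     (forall z : C, disk z ->
        q z <> RtoC 0 /\
        exists w : C, disk w /\
          (q z + z * C_derive q z / q z)%C = Rfun alpha c n w) ->
     forall z : C, disk z ->
       q z <> RtoC 0 /\ Rabs (Carg (q z)) < PI * alpha / 2).
Proof.
  intros Hc Ha Hn. split; [|split].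
  - intros z Hz. exact (Rfun_explicit alpha c n z Hc Hz).
  - apply Rfun_univalent; assumption.
  - intros q. apply open_door; assumption.
Qed.
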